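(* Let $\mathbb{F}$ be a field. For a residually finite group $\Gamma$ and $n\in\mathbb{Z}$, let $\mathsf{H}^\Gamma_n(\mathbb{F})$ be the class of all $\mathbb{Z}\Gamma$-chain complexes $X$ such that for all residual chains $\Lambda_*$ in $\Gamma$ and all $j\le n$, $$\limsup_{i\to\infty}\frac{\dim_{\mathbb{F}}H_j(\mathbb{F}\otimes_{\mathbb{Z}}X_{\Lambda_i})}{[\Gamma:\Lambda_i]}=0.$$ Then the family $(\mathsf{H}^\Gamma_n(\mathbb{F}))_{\Gamma,n\in\mathbb{Z}}$, with $\Gamma$ ranging over all residually finite groups, is an equivariantly bootstrappable property of chain complexes over $\mathbb{Z}$.
   Context: A residual chain $\Lambda_*=(\Lambda_i)_{i\in\mathbb{N}}$ in a group $\Gamma$ is a nested sequence $\Gamma=\Lambda_0\ge\Lambda_1\ge\cdots$ of finite index normal subgroups of $\Gamma$ with $\bigcap_i\Lambda_i=\{1\}$; $\Gamma$ is residually finite if it admits a residual chain. For a subgroup $\Lambda\le\Gamma$ and a $\mathbb{Z}\Gamma$-chain complex $X$, $X_\Lambda:=\mathbb{Z}\otimes_{\mathbb{Z}\Lambda}\mathrm{res}^\Gamma_\Lambda X$. Chain complexes are $\mathbb{Z}$-graded complexes of left modules; $X$ is concentrated in degrees $\ge n$ if $X_j=0$ for all $j<n$. The suspension is $(\Sigma X)_j=X_{j-1}$, $\partial^{\Sigma X}_j=-\partial^X_{j-1}$. For a chain map $f\colon X\to Y$, $\mathrm{Cone}(f)_j=X_{j-1}\oplus Y_j$ with $\partial_j(x,y)=(-\partial^X_{j-1}(x),\partial^Y_j(y)+f_{j-1}(x))$.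 A family $(\mathsf{B}^\Gamma_n)_{\Gamma,n\in\mathbb{Z}}$, with $\Gamma$ ranging over all residually finite groups and $\mathsf{B}^\Gamma_n$ a class of $\mathbb{Z}\Gamma$-chain complexes closed under isomorphisms, is an equivariantly bootstrappable property of chain complexes over $\mathbb{Z}$ if for all residually finite $\Gamma$, all $n\in\mathbb{Z}$ and all $\mathbb{Z}\Gamma$-chain complexes $X,Y$: (B-deg) if $X$ is concentrated in degrees $\ge0$, then $X\in\mathsf{B}^\Gamma_m$ for all $m<0$; (B-susp) $X\in\mathsf{B}^\Gamma_n$ if and only if $\Sigma X\in\mathsf{B}^\Gamma_{n+1}$; (B-cone) if $f\colon X\to Y$ is a $\mathbb{Z}\Gamma$-chain map, $X\in\mathsf{B}^\Gamma_{n-1}$ and $Y\in\mathsf{B}^\Gamma_n$, then $\mathrm{Cone}(f)\in\mathsf{B}^\Gamma_n$; (B-ind) if $\Delta\le\Gamma$ and $Z\in\mathsf{B}^\Delta_n$, then $\mathbb{Z}\Gamma\otimes_{\mathbb{Z}\Delta}Z\in\mathsf{B}^\Gamma_n$. *)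

(* Defs.v *)
From HB Require Import structures.
From mathcomp Require Import all_boot all_order all_algebra.
From mathcomp Require Import finmap monalg.
From mathcomp Require Import boolp classical_sets cardinality.
From mathcomp Require Import reals ereal sequences.

Set Implicit Arguments.
Unset Strict Implicit.
Unset Printing Implicit Defensive.

Import Order.TTheory GRing.Theory Num.Theory.
Local Open Scope ring_scope.

(* [{malg int[K]}] is the free abelian group on [K], with basis the [<< k >>];
   [mlift f] is the additive map sending [<< k >>] to [f k]. *)
Section FreeLift.
Variables (K : choiceType) (V : zmodType).
Implicit Types (f : K -> V) (g : {malg int[K]}).

Definition mlift f g : V := \sum_(k <- msupp g) f k *~ g@_k.

Lemma mliftEw f (d : {fset K}) g : (msupp g `<=` d)%fset ->
  mlift f g = \sum_(k <- d) f k *~ g@_k.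
Proof.
move=> gd; apply: big_fset_incl => // k _ /mcoeff_outdom ->.
by rewrite mulr0z.
Qed.

Fact mlift_is_additive f : additive (mlift f).
Proof.
move=> g1 g2; pose d := (msupp g1 `|` msupp g2)%fset.
rewrite (@mliftEw f d) ?msuppB_le// (@mliftEw f d g1) ?fsubsetUl//.
rewrite (@mliftEw f d g2) ?fsubsetUr// -sumrB.
by apply: eq_bigr => k _; rewrite mcoeffB mulrzBr.
Qed.
HB.instance Definition _ f :=
  GRing.isAdditive.Build {malg int[K]} V (mlift f) (mlift_is_additive f).

Lemma mliftU f z k : mlift f << z *g k >> = f k *~ z.
Proof. by rewrite (mliftEw f msuppU_le) big_seq_fset1 mcoeffUU. Qed.

Lemma mliftU1 f k : mlift f << k >> = f k.
Proof. by rewrite mliftU mulr1z. Qed.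

Lemma malgU_mulz z (k : K) : << z *g k >> = << k >> *~ z :> {malg int[K]}.
Proof.
apply/malgP => k'; rewrite raddfMz /= !mcoeffU.
by case: (k == k'); rewrite ?mulr1n ?mulr0n ?mul0rz// intz.
Qed.

Lemma malg_ind (P : {malg int[K]} -> Prop) :
  P 0 -> (forall x y, P x -> P y -> P (x - y)) -> (forall k, P << k >>) ->
  forall g, P g.
Proof.
move=> P0 PB PU g.
have PN x : P x -> P (- x) by move=> Px; rewrite -sub0r; apply: PB.
have PD x y : P x -> P y -> P (x + y).
  by move=> Px Py; rewrite -[y]opprK; apply/PB/PN.
have PMn x n : P x -> P (x *+ n).
  by move=> Px; elim: n => // n IHn; rewrite mulrS; apply: PD.
rewrite [g]monalgE; elim/big_ind: _ => // k _; rewrite malgU_mulz.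
by case: (g@_k) => n; [apply: PMn|apply/PN/PMn].
Qed.

End FreeLift.

Definition gring (G : groupType) : Type := {malg int[G]}.
HB.instance Definition _ (G : groupType) := GRing.Zmodule.on (gring G).

Section GroupRing.
Variable G : groupType.
Implicit Types (x y z : gring G) (k l : G).

Definition gr_one : gring G := << 1%g >>.

Definition gr_mul x y : gring G :=
  mlift (fun k => mlift (fun l => << (k * l)%g >> : gring G) y) x.

Let mliftB (f : G -> gring G) x y : mlift f (x - y) = mlift f x - mlift f y.
Proof. move: (mlift_is_additive f x y); exact. Qed.

Fact gr_mulBl x y z : gr_mul (x - y) z = gr_mul x z - gr_mul y z.
Proof. by rewrite /gr_mul mliftB. Qed.

Fact gr_mulBr x y z : gr_mul x (y - z) = gr_mul x y - gr_mul x z.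
Proof.
rewrite /gr_mul /mlift -sumrB; apply: eq_bigr => k _.
by rewrite -mulrzBl -!/(mlift _ _) mliftB.
Qed.

Fact gr_mul0g x : gr_mul 0 x = 0.
Proof. by rewrite -(subrr 0) gr_mulBl !subrr. Qed.

Fact gr_mulg0 x : gr_mul x 0 = 0.
Proof. by rewrite -(subrr 0) gr_mulBr !subrr. Qed.

Fact gr_mulDl : left_distributive gr_mul +%R.
Proof.
move=> x y z.
by rewrite -[y in LHS]opprK gr_mulBl -sub0r gr_mulBl gr_mul0g sub0r opprK.
Qed.

Fact gr_mulDr : right_distributive gr_mul +%R.
Proof.
move=> x y z.
by rewrite -[z in LHS]opprK gr_mulBr -sub0r gr_mulBr gr_mulg0 sub0r opprK.
Qed.

Fact gr_mulUU k l : gr_mul << k >> << l >> = << (k * l)%g >>.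
Proof. by rewrite /gr_mul !mliftU1. Qed.

Fact gr_mul1g : left_id gr_one gr_mul.
Proof.
elim/malg_ind => [|x y hx hy|k]; first by rewrite gr_mulg0.
  by rewrite gr_mulBr hx hy.
by rewrite gr_mulUU mul1g.
Qed.

Fact gr_mulg1 : right_id gr_one gr_mul.
Proof.
elim/malg_ind => [|x y hx hy|k]; first by rewrite gr_mul0g.
  by rewrite gr_mulBl hx hy.
by rewrite gr_mulUU mulg1.
Qed.

Fact gr_mulA : associative gr_mul.
Proof.
move=> x y z; elim/malg_ind: x => [|x x' hx hx'|k].
- by rewrite !gr_mul0g.
- by rewrite !gr_mulBl hx hx'.
elim/malg_ind: y => [|y y' hy hy'|l].
- by rewrite !(gr_mul0g, gr_mulg0).
- by rewrite !(gr_mulBl, gr_mulBr) hy hy'.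
elim/malg_ind: z => [|z z' hz hz'|m].
- by rewrite !gr_mulg0.
- by rewrite !gr_mulBr hz hz'.
by rewrite !gr_mulUU mulgA.
Qed.

Fact gr_one_neq0 : gr_one != 0.
Proof. by rewrite monalgU_eq0. Qed.

HB.instance Definition _ := GRing.Zmodule_isNzRing.Build (gring G)
  gr_mulA gr_mul1g gr_mulg1 gr_mulDl gr_mulDr gr_one_neq0.

Lemma groupring_mulUU k l :
  (<< k >> : gring G) * << l >> = << (k * l)%g >>.
Proof. exact: gr_mulUU. Qed.

End GroupRing.

Definition groupring (G : groupType) : nzRingType := gring G.

Section GroupRingLift.
Variables (G : groupType) (A : nzRingType) (u : G -> A).
Hypotheses (u1 : u 1%g = 1) (uM : forall k l, u (k * l)%g = u k * u l).

Definition gr_lift_fun : groupring G -> A := mlift u.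

Fact gr_lift_is_additive : additive gr_lift_fun.
Proof. by move=> x y; move: (@mlift_is_additive G A u x y). Qed.

Let gr_lift0 : gr_lift_fun 0 = 0.
Proof. exact: (raddf0 (mlift u)). Qed.

Fact gr_lift_is_monoid_morphism : monoid_morphism gr_lift_fun.
Proof.
split=> [|x y]; first by rewrite /gr_lift_fun mliftU1.
elim/malg_ind: x => [|x x' hx hx'|k]; first by rewrite mul0r gr_lift0 mul0r.
  by rewrite mulrBl !gr_lift_is_additive hx hx' mulrBl.
elim/malg_ind: y => [|y y' hy hy'|l]; first by rewrite mulr0 gr_lift0 mulr0.
  by rewrite mulrBr !gr_lift_is_additive hy hy' mulrBr.
by rewrite groupring_mulUU /gr_lift_fun !mliftU1 uM.
Qed.

Definition gr_lift : {rmorphism groupring G -> A} :=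
  HB.pack_for {rmorphism groupring G -> A} gr_lift_fun
    (GRing.isAdditive.Build _ _ gr_lift_fun gr_lift_is_additive)
    (GRing.isMonoidMorphism.Build _ _ gr_lift_fun gr_lift_is_monoid_morphism).

End GroupRingLift.

Definition subgrp (G : groupType) (S : groupClosed G) : Type :=
  {x : G | x \in S}.

Section Subgroup.
Variables (G : groupType) (S : groupClosed G).

HB.instance Definition _ := SubChoice.on (subgrp S).

Fact subgrp_closed : group_closed S.
Proof. by split; [exact: gpred1|exact: gpredF]. Qed.

HB.instance Definition _ :=
  SubChoice_isSubGroup.Build G (mem S) (subgrp S) subgrp_closed.

End Subgroup.

Section GroupNotions.
Variable G : groupType.
Implicit Type S : groupClosed G.
Local Open Scope group_scope.

Definition normal_subgrp S : Prop :=
  forall x g : G, x \in S -> x ^ g \in S.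

Definition lcosets_of S : set (set G) :=
  [set C | exists g, C = [set x | g^-1 * x \in S]]%classic.

Definition finite_index S : Prop := finite_set (lcosets_of S).

(* [G : S]; meaningful when [finite_index S] holds *)
Definition index_of S : nat := #|` fset_set (lcosets_of S)|%fset.

Record residual_chain (L : nat -> groupClosed G) : Prop := {
  rc_start : forall x, x \in L 0%N;
  rc_nested : forall i x, x \in L i.+1 -> x \in L i;
  rc_normal : forall i, normal_subgrp (L i);
  rc_index : forall i, finite_index (L i);
  rc_cap : forall x, (forall i, x \in L i) -> x = 1
}.

Definition residually_finite : Prop := exists L, residual_chain L.

End GroupNotions.

Definition augmentation (G : groupType) : {rmorphism groupring G -> int} :=
  @gr_lift G int (fun=> 1) erefl (fun _ _ => esym (mulr1 1)).

Definition subgrp_incl (G : groupType) (S : groupClosed G) :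
    {rmorphism groupring (subgrp S) -> groupring G} :=
  @gr_lift (subgrp S) (groupring G) (fun x => << val x >>) erefl
    (fun x y => esym (groupring_mulUU (val x) (val y))).

Definition res_mod (R S : pzRingType) (phi : {rmorphism R -> S})
  (M : lmodType S) : Type := M.

Section ResMod.
Variables (R S : pzRingType) (phi : {rmorphism R -> S}).
Implicit Types M N : lmodType S.

HB.instance Definition _ M := GRing.Zmodule.on (res_mod phi M).

Definition res_scale M (r : R) (x : res_mod phi M) : res_mod phi M :=
  phi r *: (x : M).

Fact res_scaleA M (r r' : R) (x : res_mod phi M) :
  res_scale r (res_scale r' x) = res_scale (r * r') x.
Proof. by rewrite /res_scale rmorphM scalerA. Qed.

Fact res_scale1 M : left_id 1 (@res_scale M).
Proof. by move=> x; rewrite /res_scale rmorph1 scale1r. Qed.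

Fact res_scaleDr M : right_distributive (@res_scale M) +%R.
Proof. by move=> r x y; rewrite /res_scale scalerDr. Qed.

Fact res_scaleDl M (x : res_mod phi M) :
  {morph (@res_scale M)^~ x : r r' / r + r'}.
Proof. by move=> r r'; rewrite /res_scale rmorphD scalerDl. Qed.

HB.instance Definition _ M := GRing.Zmodule_isLmodule.Build R (res_mod phi M)
  (@res_scaleA M) (@res_scale1 M) (@res_scaleDr M) (@res_scaleDl M).

Definition res_map_fun M N (f : {linear M -> N}) :
  res_mod phi M -> res_mod phi N := f.

Fact res_map_is_linear M N (f : {linear M -> N}) : linear (res_map_fun f).
Proof. by move=> r x y; rewrite /res_map_fun linearP. Qed.

HB.instance Definition _ M N (f : {linear M -> N}) :=
  GRing.isLinear.Build R (res_mod phi M) (res_mod phi N) *:%R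
    (res_map_fun f) (res_map_is_linear f).

End ResMod.

Definition restrict (R S : pzRingType) (phi : {rmorphism R -> S})
  (M : lmodType S) : lmodType R := res_mod phi M.

Definition restrict_map (R S : pzRingType) (phi : {rmorphism R -> S})
    (M N : lmodType S) (f : {linear M -> N}) :
    {linear restrict phi M -> restrict phi N} :=
  GRing.Linear.clone _ _ _ _ (@res_map_fun R S phi M N f) _.

(* Right [R]-modules are left modules over the converse ring [R^c]. *)
Section Tensor.
Variables (R : pzRingType) (M : lmodType R^c) (N : lmodType R).

Local Notation MN := (M * N)%type.

Definition rscale (x : M) (r : R) : M := (r : R^c) *: x.

(* The subgroup of the free abelian group on [M * N] spanned by the
   bilinearity and balancing relations. *)
Inductive tensor_rel : {malg int[MN]} -> Prop :=
| tensor_relDl x x' y :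
    tensor_rel (<< (x + x', y) >> - << (x, y) >> - << (x', y) >>)
| tensor_relDr x y y' :
    tensor_rel (<< (x, y + y') >> - << (x, y) >> - << (x, y') >>)
| tensor_relM x r y :
    tensor_rel (<< (rscale x r, y) >> - << (x, r *: y) >>)
| tensor_rel0 : tensor_rel 0
| tensor_relB u v : tensor_rel u -> tensor_rel v -> tensor_rel (u - v).

Definition tensor_ker : {pred {malg int[MN]}} :=
  fun u => `[< tensor_rel u >].

Fact tensor_ker_zmod_closed : zmod_closed tensor_ker.
Proof.
split=> [|u v /asboolP hu /asboolP hv]; apply/asboolP; first exact: tensor_rel0.
exact: tensor_relB.
Qed.
HB.instance Definition _ :=
  GRing.isZmodClosed.Build _ tensor_ker tensor_ker_zmod_closed.

Definition tensor : Type := Quotient.quot tensor_ker.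
HB.instance Definition _ := GRing.Zmodule.on tensor.

Definition tensor_pi (u : {malg int[MN]}) : tensor :=
  (\pi_(Quotient.quot tensor_ker) u)%qT.

Fact tensor_pi_is_additive : additive tensor_pi.
Proof. by move=> u v; rewrite /tensor_pi raddfB. Qed.
HB.instance Definition _ :=
  GRing.isAdditive.Build _ tensor tensor_pi tensor_pi_is_additive.

Definition tens (x : M) (y : N) : tensor := tensor_pi << (x, y) >>.

Lemma tensor_piP u v : tensor_pi u = tensor_pi v <-> tensor_rel (u - v).
Proof.
split=> [/eqP|uv]; first by rewrite -Quotient.idealrBE => /asboolP.
by apply/eqP; rewrite -Quotient.idealrBE; apply/asboolP.
Qed.

Let tensor_piD u v w : tensor_rel (u - v - w) ->
  tensor_pi u = tensor_pi v + tensor_pi w.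
Proof. by move=> h; rewrite -(raddfD tensor_pi) tensor_piP opprD addrA. Qed.

Lemma tensDl x x' y : tens (x + x') y = tens x y + tens x' y.
Proof. exact/tensor_piD/tensor_relDl. Qed.

Lemma tensDr x y y' : tens x (y + y') = tens x y + tens x y'.
Proof. exact/tensor_piD/tensor_relDr. Qed.

Lemma tensM x r y : tens (rscale x r) y = tens x (r *: y).
Proof. by apply/tensor_piP/tensor_relM. Qed.

Lemma tensor_ind (P : tensor -> Prop) :
  P 0 -> (forall t t', P t -> P t' -> P (t - t')) ->
  (forall x y, P (tens x y)) -> forall t, P t.
Proof.
move=> P0 PB PU t; suff: forall u, P (tensor_pi u).
  by move/(_ (repr t)); rewrite /tensor_pi reprK.
elim/malg_ind => [|u v hu hv|[x y]]; [by rewrite raddf0 | | exact: PU].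
by rewrite raddfB; apply: PB.
Qed.

Section Lift.
Variables (A : zmodType) (b : M -> N -> A).
Hypotheses (bDl : forall x x' y, b (x + x') y = b x y + b x' y)
           (bDr : forall x y y', b x (y + y') = b x y + b x y')
           (bM : forall x r y, b (rscale x r) y = b x (r *: y)).

Definition tensor_lift_fun (t : tensor) : A :=
  mlift (fun p => b p.1 p.2) (repr t).

Let tensor_rel_lift u : tensor_rel u -> mlift (fun p => b p.1 p.2) u = 0.
Proof.
elim=> {u} [x x' y|x y y'|x r y||u v _ hu _ hv]; rewrite ?raddf0// !raddfB /=.
- by rewrite !mliftU1 /= bDl addrAC addrK subrr.
- by rewrite !mliftU1 /= bDr addrAC addrK subrr.
- by rewrite !mliftU1 /= bM subrr.
- by rewrite hu hv subrr.
Qed.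

Let tensor_lift_pi u :
  tensor_lift_fun (tensor_pi u) = mlift (fun p => b p.1 p.2) u.
Proof.
apply/eqP; rewrite -subr_eq0 -raddfB; apply/eqP/tensor_rel_lift/tensor_piP.
by rewrite /tensor_pi reprK.
Qed.

Fact tensor_lift_is_additive : additive tensor_lift_fun.
Proof.
move=> t t'; have e s : tensor_pi (repr s) = s by rewrite /tensor_pi reprK.
by rewrite -[t]e -[t']e -raddfB !tensor_lift_pi raddfB.
Qed.

Definition tensor_lift : {additive tensor -> A} :=
  HB.pack_for {additive tensor -> A} tensor_lift_fun
    (GRing.isAdditive.Build _ _ tensor_lift_fun tensor_lift_is_additive).

Lemma tensor_liftE x y : tensor_lift (tens x y) = b x y.
Proof. by rewrite /tensor_lift /= /tens tensor_lift_pi mliftU1. Qed.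

End Lift.

End Tensor.

Section TensorMap.
Variables (R : pzRingType) (M M' : lmodType R^c) (N N' : lmodType R).
Variables (f : {linear M -> M'}) (g : {linear N -> N'}).

Let tens_fg x y : tensor M' N' := tens (f x) (g y).

Let tens_fgDl x x' y : tens_fg (x + x') y = tens_fg x y + tens_fg x' y.
Proof. by rewrite /tens_fg raddfD tensDl. Qed.

Let tens_fgDr x y y' : tens_fg x (y + y') = tens_fg x y + tens_fg x y'.
Proof. by rewrite /tens_fg raddfD tensDr. Qed.

Let tens_fgM x r y : tens_fg (rscale x r) y = tens_fg x (r *: y).
Proof. by rewrite /tens_fg /rscale !linearZ -tensM. Qed.

Definition tensor_map : {additive tensor M N -> tensor M' N'} :=
  tensor_lift tens_fgDl tens_fgDr tens_fgM.

Lemma tensor_mapE x y : tensor_map (tens x y) = tens (f x) (g y).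
Proof. exact: tensor_liftE. Qed.

End TensorMap.

Section ExtMod.
Variables (R S : pzRingType) (phi : {rmorphism R -> S}).

Definition conv_fun : R^c -> S^c := phi.

Fact conv_is_additive : additive conv_fun.
Proof. exact: (raddfB phi). Qed.

Fact conv_is_monoid_morphism : monoid_morphism conv_fun.
Proof. by split=> [|x y]; [exact: (rmorph1 phi)|exact: (rmorphM phi)]. Qed.

Definition conv : {rmorphism R^c -> S^c} :=
  HB.pack_for {rmorphism R^c -> S^c} conv_fun
    (GRing.isAdditive.Build _ _ conv_fun conv_is_additive)
    (GRing.isMonoidMorphism.Build _ _ conv_fun conv_is_monoid_morphism).

Definition ring_rmod : lmodType R^c := restrict conv (S^c)^o.

Lemma ring_rmodE (s : S) (r : R) :
  rscale (s : ring_rmod) r = s * phi r :> S.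
Proof. by []. Qed.

Definition lmul_fun (s : S) : ring_rmod -> ring_rmod := fun x : S => s * x.

Fact lmul_is_linear s : linear (lmul_fun s).
Proof.
move=> r x y; change (s * ((x : S) * phi r + y) = s * x * phi r + s * y).
by rewrite mulrDr mulrA.
Qed.

Definition lmul (s : S) : {linear ring_rmod -> ring_rmod} :=
  HB.pack_for {linear ring_rmod -> ring_rmod} (lmul_fun s)
    (GRing.isLinear.Build R^c ring_rmod ring_rmod *:%R (lmul_fun s)
       (lmul_is_linear s)).

(* [S (x)_R N], with [S] acting by left multiplication on the first factor *)
Definition ext_mod (N : lmodType R) : Type := tensor ring_rmod N.
HB.instance Definition _ N := GRing.Zmodule.on (ext_mod N).

Implicit Type N : lmodType R.

Definition etens N (x : S) (y : N) : ext_mod N := tens (x : ring_rmod) y.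

Lemma etensDl N x x' (y : N) : etens (x + x') y = etens x y + etens x' y.
Proof. exact: tensDl. Qed.

Lemma etensDr N x (y y' : N) : etens x (y + y') = etens x y + etens x y'.
Proof. exact: tensDr. Qed.

Lemma etens0 N x : etens x (0 : N) = 0.
Proof. by apply: (addIr (etens x (0 : N))); rewrite -etensDr !add0r. Qed.

Lemma etensM N x r (y : N) : etens (x * phi r) y = etens x (r *: y).
Proof. exact: tensM. Qed.

Lemma ext_ind N (P : ext_mod N -> Prop) :
  P 0 -> (forall t t', P t -> P t' -> P (t - t')) ->
  (forall x y, P (etens x y)) -> forall t, P t.
Proof. exact: tensor_ind. Qed.

Section Scale.
Variable N : lmodType R.

Definition ext_scale (s : S) : ext_mod N -> ext_mod N :=
  tensor_map (lmul s) (GRing.Linear.clone _ _ _ _ (@idfun N) _).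

Let ext_scaleE s (x : S) (y : N) :
  ext_scale s (etens x y) = etens (s * x) y.
Proof. exact: tensor_mapE. Qed.

Let ext_scaleB s : {morph ext_scale s : t t' / t - t'}.
Proof. exact: raddfB. Qed.

Let ext_scale0 s : ext_scale s 0 = 0.
Proof. exact: raddf0. Qed.

Fact ext_scaleA s s' t : ext_scale s (ext_scale s' t) = ext_scale (s * s') t.
Proof.
elim/ext_ind: t => [|t t' ht ht'|x y]; rewrite ?ext_scale0 ?ext_scaleB //.
  by rewrite ht ht'.
by rewrite !ext_scaleE mulrA.
Qed.

Fact ext_scale1 : left_id 1 ext_scale.
Proof.
elim/ext_ind => [|t t' ht ht'|x y]; rewrite ?ext_scale0 ?ext_scaleB //.
  by rewrite ht ht'.
by rewrite ext_scaleE mul1r.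
Qed.

Fact ext_scaleDr : right_distributive ext_scale +%R.
Proof. by move=> s; exact: raddfD. Qed.

Fact ext_scaleDl t : {morph ext_scale^~ t : s s' / s + s'}.
Proof.
move=> s s'; elim/ext_ind: t => [|t t' ht ht'|x y].
- by rewrite !ext_scale0 addr0.
- by rewrite !ext_scaleB ht ht' opprD addrACA.
by rewrite !ext_scaleE mulrDl etensDl.
Qed.

HB.instance Definition _ := GRing.Zmodule_isLmodule.Build S (ext_mod N)
  ext_scaleA ext_scale1 ext_scaleDr ext_scaleDl.

Lemma etensZ s (x : S) (y : N) :
  s *: etens x y = etens (s * x) y.
Proof. exact: ext_scaleE. Qed.

End Scale.

Section Map.
Variables (N N' : lmodType R) (g : {linear N -> N'}).

Definition ext_map_fun : ext_mod N -> ext_mod N' :=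
  tensor_map (GRing.Linear.clone _ _ _ _ (@idfun ring_rmod) _) g.

Lemma ext_map_funE (x : S) y :
  ext_map_fun (etens x y) = etens x (g y).
Proof. exact: tensor_mapE. Qed.

Fact ext_map_is_linear : linear ext_map_fun.
Proof.
have fB : {morph ext_map_fun : t t' / t - t'} by exact: raddfB.
have fD : {morph ext_map_fun : t t' / t + t'} by exact: raddfD.
have f0 : ext_map_fun 0 = 0 by exact: raddf0.
move=> s t t'; rewrite fD; congr (_ + _).
elim/ext_ind: t => [|u v hu hv|x y]; first by rewrite scaler0 f0 scaler0.
  by rewrite scalerBr !fB hu hv scalerBr.
by rewrite etensZ !ext_map_funE etensZ.
Qed.

HB.instance Definition _ := GRing.isLinear.Build S (ext_mod N) (ext_mod N')
  *:%R ext_map_fun ext_map_is_linear.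

End Map.
End ExtMod.

Definition extend (R S : pzRingType) (phi : {rmorphism R -> S})
  (N : lmodType R) : lmodType S := ext_mod phi N.

Definition extend_map (R S : pzRingType) (phi : {rmorphism R -> S})
    (N N' : lmodType R) (g : {linear N -> N'}) :
    {linear extend phi N -> extend phi N'} :=
  GRing.Linear.clone _ _ _ _ (@ext_map_fun R S phi N N' g) _.

Lemma extend_mapE (R S : pzRingType) (phi : {rmorphism R -> S})
    (N N' : lmodType R) (g : {linear N -> N'}) (x : S) (y : N) :
  extend_map phi g (etens phi x y) = etens phi x (g y).
Proof. exact: ext_map_funE. Qed.

Record chain_complex (R : pzRingType) := ChainComplex {
  cc_obj :> int -> lmodType R;
  cc_d : forall j : int, {linear cc_obj j -> cc_obj (j - 1)};
  cc_dd : forall j (x : cc_obj j), cc_d (j - 1) (cc_d j x) = 0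
}.

Record chain_map (R : pzRingType) (X Y : chain_complex R) := ChainMap {
  cm_map :> forall j : int, {linear X j -> Y j};
  cm_comm : forall j (x : X j),
    cm_map (j - 1) (cc_d X j x) = cc_d Y j (cm_map j x)
}.

Definition cc_iso (R : pzRingType) (X Y : chain_complex R) : Prop :=
  exists f : chain_map X Y, forall j, bijective (f j).

Definition concentrated_ge (R : pzRingType) (n : int) (X : chain_complex R) :
  Prop := forall j, j < n -> forall x : X j, x = 0.

Section ResExtComplex.
Variables (R S : pzRingType) (phi : {rmorphism R -> S}).

Definition res_complex (X : chain_complex S) : chain_complex R :=
  @ChainComplex R (fun j => restrict phi (X j))
    (fun j => restrict_map phi (cc_d X j)) (@cc_dd S X).

Fact ext_complex_dd (X : chain_complex R) j (t : extend phi (X j)) :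
  extend_map phi (cc_d X (j - 1)) (extend_map phi (cc_d X j) t) = 0.
Proof.
elim/ext_ind: t => [|u v hu hv|x y]; first by rewrite !linear0.
  by rewrite !linearB hu hv subrr.
by rewrite !extend_mapE cc_dd etens0.
Qed.

Definition ext_complex (X : chain_complex R) : chain_complex S :=
  @ChainComplex S (fun j => extend phi (X j))
    (fun j => extend_map phi (cc_d X j)) (@ext_complex_dd X).

End ResExtComplex.

Section Suspension.
Variables (R : pzRingType) (X : chain_complex R).

Definition susp_d (j : int) : {linear X (j - 1) -> X (j - 1 - 1)} :=
  GRing.Linear.clone _ _ _ _ (\- cc_d X (j - 1))%R _.

Fact susp_dd j (x : X (j - 1)) : susp_d (j - 1) (susp_d j x) = 0.
Proof. by rewrite /= linearN cc_dd !oppr0. Qed.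

Definition susp : chain_complex R :=
  @ChainComplex R (fun j => X (j - 1)) susp_d susp_dd.

End Suspension.

Section Cone.
Variables (R : pzRingType) (X Y : chain_complex R) (f : chain_map X Y).

Definition cone_obj (j : int) : lmodType R := (X (j - 1) * Y j)%type.

Definition cone_d_fun (j : int) (p : cone_obj j) : cone_obj (j - 1) :=
  (- cc_d X (j - 1) p.1, cc_d Y j p.2 + f (j - 1) p.1).

Fact cone_d_is_linear j : linear (@cone_d_fun j).
Proof.
move=> a [x y] [x' y']; rewrite /cone_d_fun /= !linearP.
by congr (_, _); rewrite /= scalerDr [in RHS]addrACA.
Qed.
HB.instance Definition _ j := GRing.isLinear.Build R (cone_obj j)
  (cone_obj (j - 1)) *:%R (@cone_d_fun j) (@cone_d_is_linear j).

Definition cone_d (j : int) : {linear cone_obj j -> cone_obj (j - 1)} :=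
  @cone_d_fun j.

Fact cone_dd j (p : cone_obj j) : cone_d (j - 1) (cone_d j p) = 0.
Proof.
case: p => x y; rewrite /cone_d /= /cone_d_fun /=; congr (_, _).
  by rewrite linearN cc_dd !oppr0.
by rewrite linearD cc_dd add0r linearN cm_comm subrr.
Qed.

Definition cone : chain_complex R := ChainComplex cone_dd.

End Cone.

Section QuotMod.
Variables (R : pzRingType) (V : lmodType R) (W : submodClosed V).

(* [submodClosed] records stability under [0], [+] and scaling only, whereas
   quotients are taken by a [zmodClosed] predicate. *)
Definition submod_pred : {pred V} := fun x => x \in W.

Fact submod_pred_zmod_closed : zmod_closed submod_pred.
Proof.
split=> [|x y Wx Wy]; first exact: rpred0.
by apply: rpredD => //; rewrite -scaleN1r; apply: rpredZ.
Qed.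
HB.instance Definition _ :=
  GRing.isZmodClosed.Build V submod_pred submod_pred_zmod_closed.

Definition quotmod : Type := Quotient.quot submod_pred.
HB.instance Definition _ := GRing.Zmodule.on quotmod.

Definition quotmod_pi (x : V) : quotmod :=
  (\pi_(Quotient.quot submod_pred) x)%qT.

Lemma quotmod_piP x y : quotmod_pi x = quotmod_pi y <-> x - y \in W.
Proof.
split=> [/eqP|xy]; first by rewrite -Quotient.idealrBE.
by apply/eqP; rewrite -Quotient.idealrBE.
Qed.

Lemma quotmod_ind (P : quotmod -> Prop) :
  (forall x, P (quotmod_pi x)) -> forall q, P q.
Proof. by move=> PW q; have := PW (repr q); rewrite /quotmod_pi reprK. Qed.

Fact quotmod_piD : {morph quotmod_pi : x y / x + y}.
Proof. by move=> x y; rewrite /quotmod_pi (raddfD (\pi_(Quotient.quot _))%qT). Qed.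

Definition quotmod_scale (a : R) (q : quotmod) : quotmod :=
  quotmod_pi (a *: repr q).

Let quotmod_scale_pi a x : quotmod_scale a (quotmod_pi x) = quotmod_pi (a *: x).
Proof.
apply/quotmod_piP; rewrite -scalerBr; apply: rpredZ.
by apply/quotmod_piP; rewrite /quotmod_pi reprK.
Qed.

Fact quotmod_scaleA a b q :
  quotmod_scale a (quotmod_scale b q) = quotmod_scale (a * b) q.
Proof. by elim/quotmod_ind: q => x; rewrite !quotmod_scale_pi scalerA. Qed.

Fact quotmod_scale1 : left_id 1 quotmod_scale.
Proof. by elim/quotmod_ind => x; rewrite quotmod_scale_pi scale1r. Qed.

Fact quotmod_scaleDr : right_distributive quotmod_scale +%R.
Proof.
move=> a; elim/quotmod_ind => x; elim/quotmod_ind => y.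
by rewrite -quotmod_piD !quotmod_scale_pi scalerDr quotmod_piD.
Qed.

Fact quotmod_scaleDl q : {morph quotmod_scale^~ q : a b / a + b}.
Proof.
move=> a b; elim/quotmod_ind: q => x.
by rewrite !quotmod_scale_pi scalerDl quotmod_piD.
Qed.

HB.instance Definition _ := GRing.Zmodule_isLmodule.Build R quotmod
  quotmod_scaleA quotmod_scale1 quotmod_scaleDr quotmod_scaleDl.

Fact quotmod_pi_is_linear : linear quotmod_pi.
Proof. by move=> a x y; rewrite quotmod_piD -quotmod_scale_pi. Qed.
HB.instance Definition _ :=
  GRing.isLinear.Build R V quotmod *:%R quotmod_pi quotmod_pi_is_linear.

End QuotMod.

Section Homology.
Variables (R : pzRingType) (X : chain_complex R).

Section Degree.
Variable j : int.

Definition cycle_pred : {pred X j} := fun x => cc_d X j x == 0.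

Fact cycle_pred_submod_closed : submod_closed cycle_pred.
Proof.
split=> [|a x y /eqP dx /eqP dy]; apply/eqP; first exact: linear0.
by rewrite linearP dx dy scaler0 addr0.
Qed.
HB.instance Definition _ :=
  GRing.isSubmodClosed.Build R (X j) cycle_pred cycle_pred_submod_closed.

Definition cycles : Type := {x : X j | x \in cycle_pred}.
HB.instance Definition _ := SubChoice.on cycles.
HB.instance Definition _ := [SubChoice_isSubLmodule of cycles by <:].

(* The differential [X_{j+1} -> X_j]; its codomain is literally indexed by
   [j + 1 - 1]. *)
Definition d_into (x : X (j + 1)) : X j :=
  ecast k (X k) (addrK 1 j : j + 1 - 1 = j) (cc_d X (j + 1) x).

Fact d_into_is_linear : linear d_into.
Proof.
have castP (U : lmodType R) k l (e : k = l) (f : {linear U -> X k}) :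
    linear (fun x => ecast k (X k) e (f x)).
  by case: l / e => a x y; exact: linearP.
exact: castP.
Qed.
HB.instance Definition _ :=
  GRing.isLinear.Build R (X (j + 1)) (X j) *:%R d_into d_into_is_linear.

Definition boundary_pred : {pred cycles} :=
  fun z => `[< exists x, val z = d_into x >].

Fact boundary_pred_submod_closed : submod_closed boundary_pred.
Proof.
split=> [|a u v /asboolP[x ux] /asboolP[y vy]]; apply/asboolP.
  by exists 0; rewrite !linear0.
by exists (a *: x + y); rewrite d_into_is_linear -ux -vy linearP.
Qed.
HB.instance Definition _ :=
  GRing.isSubmodClosed.Build R cycles boundary_pred boundary_pred_submod_closed.

Definition homology : lmodType R := quotmod boundary_pred.

End Degree.
End Homology.

Section Dimension.
Variables (R : realType) (F : fieldType) (V : lmodType F).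

Definition is_basis (n : nat) (b : 'I_n -> V) : Prop :=
  (forall c : 'I_n -> F, \sum_(i < n) c i *: b i = 0 -> forall i, c i = 0) /\
  (forall v, exists c : 'I_n -> F, v = \sum_(i < n) c i *: b i).

Definition dimE : \bar R :=
  xget +oo%E [set d | exists n (b : 'I_n -> V), is_basis b /\ d = n%:R%:E]%classic.

End Dimension.

Definition coinvariants (G : groupType) (L : groupClosed G)
    (X : chain_complex (groupring G)) : chain_complex int :=
  ext_complex (augmentation (subgrp L)) (res_complex (subgrp_incl L) X).

Definition induced (G : groupType) (D : groupClosed G)
    (X : chain_complex (groupring (subgrp D))) : chain_complex (groupring G) :=
  ext_complex (subgrp_incl D) X.

Definition base_change (F : fieldType) (X : chain_complex int) :
    chain_complex F :=
  ext_complex (intmul 1 : {rmorphism int -> F}) X.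

(* The classes [B G n] are only constrained for residually finite [G]; the
   values of the family on other groups play no role. *)
Record equivariantly_bootstrappable
    (B : forall G : groupType, int -> chain_complex (groupring G) -> Prop) :
    Prop := {
  boot_iso : forall G, residually_finite G ->
    forall (n : int) (X Y : chain_complex (groupring G)),
      cc_iso X Y -> B G n X -> B G n Y;
  boot_deg : forall G, residually_finite G ->
    forall X : chain_complex (groupring G), concentrated_ge 0 X ->
      forall m : int, m < 0 -> B G m X;
  boot_susp : forall G, residually_finite G ->
    forall (n : int) (X : chain_complex (groupring G)),
      B G n X <-> B G (n + 1) (susp X);
  boot_cone : forall G, residually_finite G ->
    forall (n : int) (X Y : chain_complex (groupring G)) (f : chain_map X Y),
      B G (n - 1) X -> B G n Y -> B G n (cone f);
  boot_ind : forall G, residually_finite G ->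
    forall (n : int) (D : groupClosed G) (Z : chain_complex (groupring (subgrp D))),
      B (subgrp D) n Z -> B G n (induced Z)
}.

Definition H_class (R : realType) (F : fieldType) (G : groupType) (n : int)
    (X : chain_complex (groupring G)) : Prop :=
  forall L, residual_chain L -> forall j : int, j <= n ->
    limn_esup (fun i =>
      dimE R (homology (base_change F (coinvariants (L i) X)) j)
        / (index_of (L i))%:R%:E)%E = 0%E.

(* Main.v *)
(** The homology of a mapping cone sits in an exact sequence
    [H_j Y -> H_j (cone f) -> H_(j-1) X], which survives passing to
    coinvariants because the cone splits degreewise; so dimensions are
    subadditive. For induction, if [L] is normal of finite index, then the
    coinvariants of an induced complex split as a sum of copies of the
    coinvariants of [Z] under the trace of [L] on [D], one for each of the
    [G : L D] double cosets. As [G : L] = [G : L D] [D : L meet D], and as the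
    traces of a residual chain of [G] form a residual chain of [D], the
    normalised dimensions for [D] bound those for [G]. *)

Require Import Defs.
From mathcomp Require Import all_boot all_algebra.
From mathcomp Require Import reals.
From HB Require Import structures.
From mathcomp Require Import all_order finmap monalg.
From mathcomp Require Import boolp classical_sets cardinality.
From mathcomp Require Import ereal topology normedtype sequences.

Set Implicit Arguments.
Unset Strict Implicit.
Unset Printing Implicit Defensive.

Import Order.TTheory GRing.Theory Num.Theory.
Local Open Scope ring_scope.

(** * Spans modulo a subspace *)

(** [dimE] is the size of a finite basis, or [+oo], of a quotient of a subtype. To avoid both
    infinite values and quotients, [dimE <= n] is traded for a list of at most n cycles that span
    all cycles modulo boundaries ([dim_le]). Each comparison of dimensions then becomes a transfer
    of such lists, and [+oo] is met only in the three lemmas that turn these transfers into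
    inequalities of [dimE]. No direct sum is formed for induction: it is enough to have, for each
    double coset representative, an embedding and a projection compatible with the differentials,
    such that every element is the sum of its embedded projections. Degrees are written [k - 1],
    since the boundaries there are the image of the differential on [X k] without any cast. *)

Section Span.
Variables (F : fieldType) (V : lmodType F).
Implicit Types (B P W Z : V -> Prop) (s t : seq V).

Definition subspace P : Prop :=
  P 0 /\ forall (a : F) u v, P u -> P v -> P (a *: u + v).

Section SubspaceTheory.
Variables (P : V -> Prop) (hP : subspace P).

Lemma subspace0 : P 0.
Proof. by case: hP. Qed.

Lemma subspaceP (a : F) u v : P u -> P v -> P (a *: u + v).
Proof. by case: hP => _; apply. Qed.

Lemma subspaceZ (a : F) u : P u -> P (a *: u).
Proof. by move=> Pu; rewrite -[_ *: _]addr0; apply: subspaceP subspace0. Qed.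

Lemma subspaceD u v : P u -> P v -> P (u + v).
Proof. by move=> Pu Pv; rewrite -[u]scale1r; apply: subspaceP. Qed.

Lemma subspaceB u v : P u -> P v -> P (u - v).
Proof.
by move=> Pu Pv; rewrite addrC -scaleN1r; apply: subspaceP.
Qed.

Lemma subspace_sum (I : eqType) (r : seq I) (E : I -> V) :
  (forall i, i \in r -> P (E i)) -> P (\sum_(i <- r) E i).
Proof.
move=> PE; rewrite big_seq; elim/big_ind: _ => //; first exact: subspace0.
by move=> u v; exact: subspaceD.
Qed.

End SubspaceTheory.

(** Linear combinations of s modulo B, one coefficient peeled off per list entry, so that proofs go
    by induction on s without indexed sums. *)
Fixpoint span B s : V -> Prop :=
  if s is x :: s' then fun v => exists c : F, span B s' (v - c *: x) else B.

Lemma subspace_span B s : subspace B -> subspace (span B s).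
Proof.
move=> hB; elim: s => //= x s IHs; split=> [|a u v [c hc] [d hd]].
  by exists 0; rewrite scale0r subr0; apply: subspace0 IHs.
exists (a * c + d); have -> : a *: u + v - (a * c + d) *: x =
    a *: (u - c *: x) + (v - d *: x).
  by rewrite scalerBr scalerDl scalerA opprD addrACA.
exact: subspaceP.
Qed.

Lemma span_base B s v : subspace B -> B v -> span B s v.
Proof.
by move=> hB Bv; elim: s => //= x s IHs; exists 0; rewrite scale0r subr0.
Qed.

Lemma span_mem B s v : subspace B -> v \in s -> span B s v.
Proof.
move=> hB; elim: s => //= x s IHs; rewrite inE => /orP[/eqP->|/IHs sv].
  exists 1; rewrite scale1r subrr.
  exact: subspace0 (subspace_span s hB).
by exists 0; rewrite scale0r subr0.
Qed.

Lemma span_min B s P : subspace P -> (forall v, B v -> P v) ->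
  (forall v, v \in s -> P v) -> forall v, span B s v -> P v.
Proof.
move=> hP BP; elim: s => //= x s IHs sP v [c hc].
have Px : P x by apply: sP; rewrite mem_head.
rewrite -(subrK (c *: x) v); apply: (subspaceD hP) (subspaceZ hP c Px).
by apply: IHs hc => u us; apply: sP; rewrite inE us orbT.
Qed.

Lemma span0_coef s v : span (eq^~ 0) s v ->
  exists c : 'I_(size s) -> F, v = \sum_i c i *: s`_i.
Proof.
elim: s v => [v /= ->|x s IHs v /= [c /IHs[d vE]]].
  by exists (fun=> 0); rewrite big_ord0.
exists (fun i => if unlift ord0 i is Some j then d j else c).
rewrite big_ord_recl unlift_none /= -[LHS](subrK (c *: x)) vE addrC.
congr (_ + _); by under [RHS]eq_bigr => i _ do rewrite liftK.
Qed.

(* The greedy proof that a subspace of a space spanned by [n] vectors modulo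
   [B] is itself spanned by at most [n] of its own vectors. *)
Lemma span_subspace B W s : subspace B -> subspace W ->
  (forall w, W w -> span B s w) ->
  exists t, [/\ (size t <= size s)%N, forall w, w \in t -> W w
              & forall w, W w -> span B t w].
Proof.
move=> hB; elim: s W => [|x s IHs] W hW Ws; first by exists [::].
have hs := subspace_span s hB.
have hW' : subspace (fun w => W w /\ span B s w).
  split=> [|a u v [Wu su] [Wv sv]]; first by split; exact: subspace0.
  by split; exact: subspaceP.
have [t [tle tW tspan]] := IHs _ hW' (fun w => @proj2 _ _).
(* If some w in W involves x with a nonzero coefficient modulo [span B s], it is one more generator,
   and subtracting multiples of it clears x from the other elements of W. Otherwise W lies in
   [span B s] already and t suffices. *)
have [[w [c [Ww c0 sw]]]|noc] :=
    pselect (exists w c, [/\ W w, c != 0 & span B s (w - c *: x)]).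
  exists (w :: t); split=> //= [v|v Wv].
    by rewrite inE => /orP[/eqP->//|/tW[]].
  have [d sv] := Ws v Wv; exists (d / c); apply: tspan; split.
    by apply: subspaceB => //; apply: subspaceZ.
  have -> : v - (d / c) *: w = - (d / c) *: (w - c *: x) + (v - d *: x).
    by rewrite scalerBr scalerA mulNr divfK// !scaleNr opprK addrACA subrr
       addr0 addrC.
  exact: subspaceP.
exists t; split=> [|w /tW[]//|w Ww]; first exact: leqW.
have [c sw] := Ws w Ww.
have [c0|c0] := eqVneq c 0; last by case: noc; exists w, c.
by apply: tspan; split=> //; move: sw; rewrite c0 scale0r subr0.
Qed.

(* The dimension of [Z / B] is at most [n]. *)
Definition dim_le Z B (n : nat) : Prop := exists s,
  [/\ (size s <= n)%N, forall z, z \in s -> Z z & forall z, Z z -> span B s z].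

End Span.

Lemma span_map (F : fieldType) (V V' : lmodType F) (f : {linear V -> V'})
    (B : V -> Prop) (B' : V' -> Prop) s v :
  (forall u, B u -> B' (f u)) -> span B s v -> span B' [seq f x | x <- s] (f v).
Proof.
move=> BB'; elim: s v => [v /BB'//|x s IHs v /= [c /IHs]].
by exists c; rewrite -linearZ -linearB.
Qed.

Section Dimension.
Variables (R : realType) (F : fieldType) (V : lmodType F).

Lemma is_basis_size_le n m (b : 'I_n -> V) (s : 'I_m -> V) : is_basis b ->
  (forall v, exists c : 'I_m -> F, v = \sum_i c i *: s i) -> (n <= m)%N.
Proof.
move=> [bfree _] sspan; rewrite leqNgt; apply/negP => ltmn.
have /choice[c cE] i : exists c : 'I_m -> F, b i = \sum_j c j *: s j.
  exact: sspan.
pose M : 'M[F]_(n, m) := \matrix_(i, j) c i j.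
(* With fewer columns than rows the coefficient matrix kills a nonzero row vector, which is a
   nontrivial relation on the basis. *)
have : kermx M != 0.
  rewrite -mxrank_eq0 mxrank_ker -lt0n subn_gt0.
  exact: leq_ltn_trans (rank_leq_col M) ltmn.
case/rowV0Pn => u /sub_kermxP uM /rV0Pn[i]; apply/negP; rewrite negbK.
apply/eqP/(bfree (fun i => u 0 i)).
under eq_bigr => k _ do rewrite cE scaler_sumr.
rewrite exchange_big /= big1// => j _.
under eq_bigr => k _ do rewrite scalerA.
rewrite -scaler_suml -[RHS](scale0r (s j)); congr (_ *: _).
transitivity ((u *m M) 0 j); last by rewrite uM mxE.
by rewrite mxE; apply: eq_bigr => k _; rewrite mxE.
Qed.

Lemma is_basis_dimE n (b : 'I_n -> V) : is_basis b -> dimE R V = n%:R%:E.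
Proof.
move=> hb; apply: xget_unique; first by exists n, b.
move=> _ [m [b' [hb' ->]]]; suff -> : n = m by [].
apply/eqP; rewrite eqn_leq (is_basis_size_le hb (proj2 hb')).
by rewrite (is_basis_size_le hb' (proj2 hb)).
Qed.

Lemma spanned_basis n (b : 'I_n -> V) :
  (forall v, exists c : 'I_n -> F, v = \sum_i c i *: b i) ->
  exists m (b' : 'I_m -> V), is_basis b' /\ (m <= n)%N.
Proof.
elim: n b => [|n IHn] b bspan.
  by exists 0%N, b; split=> //; split=> // c _ [].
have [bfree|] := pselect (forall c : 'I_n.+1 -> F,
    \sum_i c i *: b i = 0 -> forall i, c i = 0).
  by exists n.+1, b; split.
move=> /existsNP[c] /not_implyP[c0] /existsNP[i /eqP ci].
have [v|m [b' [hb' lemn]]] := IHn (fun j => b (lift i j)).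
  have [d ->] := bspan v.
  (* Subtracting [d i / c i] times the relation c from the expansion d of v removes the i-th
     vector. *)
  exists (fun j => d (lift i j) - d i / c i * c (lift i j)).
  under [RHS]eq_bigr => j _ do rewrite scalerBl -scalerA.
  rewrite sumrB -scaler_sumr (bigD1_ord i) //=.
  move: c0; rewrite (bigD1_ord i) //= addrC => /eqP.
  by rewrite addr_eq0 => /eqP ->; rewrite scalerN opprK scalerA divfK// addrC.
by exists m, b'; split=> //; apply: leqW.
Qed.

Lemma dimE_le n (s : seq V) : (size s <= n)%N ->
  (forall v, span (eq^~ 0) s v) -> (dimE R V <= n%:R%:E)%E.
Proof.
move=> sn sspan.
have [m [b [hb mle]]] := @spanned_basis (size s) (fun i => s`_i)
  (fun v => span0_coef (sspan v)).
by rewrite (is_basis_dimE hb) lee_fin ler_nat (leq_trans mle).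
Qed.

Lemma dimE_basis : dimE R V = +oo%E \/
  exists n (b : 'I_n -> V), is_basis b /\ dimE R V = n%:R%:E.
Proof.
have [[n [b hb]]|nob] := pselect (exists n (b : 'I_n -> V), is_basis b).
  by right; exists n, b; split=> //; apply: (is_basis_dimE hb).
left; apply: xgetPN => d [n [b [hb _]]]; apply: nob; by exists n, b.
Qed.

Lemma dimE_ge0 : (0 <= dimE R V)%E.
Proof.
by case: dimE_basis => [->|[n [b [_ ->]]]]; rewrite ?leey// lee_fin ler0n.
Qed.

End Dimension.

(** * Dimension of homology *)

Section HomologyDim.
Variables (R : realType) (F : fieldType) (X : chain_complex F).

Definition cycle (j : int) (x : X j) : Prop := cc_d X j x = 0.

Definition boundary (j : int) (x : X j) : Prop := exists y, x = d_into y.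

Lemma subspace_cycle j : subspace (@cycle j).
Proof.
split=> [|a u v du dv]; first exact: linear0.
by rewrite /cycle linearP du dv scaler0 addr0.
Qed.

Lemma subspace_boundary j : subspace (@boundary j).
Proof.
split=> [|a u v [x ->] [y ->]].
  by exists 0; rewrite (linear0 (@d_into _ X j)).
by exists (a *: x + y); rewrite (linearP (@d_into _ X j)).
Qed.

(** In degree [k - 1] the cast inside [d_into] can be eliminated: once [k - 1 + 1] is generalised to
    an l equal to k, the cast runs along an equality of an integer with itself. *)
Lemma boundaryE k (x : X (k - 1)) :
  boundary x <-> exists y : X k, x = cc_d X k y.
Proof.
have shift l (kl : k = l) (e : l - 1 = k - 1) :
    (exists y, x = ecast i (X i) e (cc_d X l y)) <->
    (exists y : X k, x = cc_d X k y).
  by case: l / kl e => e; rewrite (eq_irrelevance e (erefl _)).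
by apply: shift; rewrite subrK.
Qed.

(** Brings an arbitrary degree into the form required by [boundaryE]. *)
Lemma int_pred_ind (P : int -> Prop) : (forall k, P (k - 1)) -> forall j, P j.
Proof. by move=> Pk j; rewrite -(addrK 1 j). Qed.

(** From here on homology is handled through predicates on [X j] itself: representatives of a basis
    span the cycles modulo boundaries, and conversely the classes of spanning cycles span
    homology. *)
Lemma homology_dim_le j n :
  (dimE R (homology X j) <= n%:R%:E)%E <-> dim_le (@cycle j) (@boundary j) n.
Proof.
have hZ := subspace_cycle j; have hB := subspace_boundary j.
have cycleP x : reflect (@cycle j x) (x \in cycle_pred (X := X) (j := j)).
  exact: eqP.
pose cl (z : cycles X j) : homology X j :=
  quotmod_pi (boundary_pred (X := X) (j := j)) z.
have clP z z' : cl z = cl z' <-> boundary (val z - val z').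
  by rewrite /cl quotmod_piP; split=> [/asboolP//|h]; apply/asboolP.
have clL a z z' : cl (a *: z + z') = a *: cl z + cl z'.
  exact: quotmod_pi_is_linear.
split=> [|[s [sn sZ sspan]]].
  have [->|[m [b [[_ bspan] ->]]]] := dimE_basis R (homology X j).
    by rewrite leye_eq.
  rewrite lee_fin ler_nat => lemn.
  have /choice[z zE] i : exists z, b i = cl z.
    by elim/quotmod_ind: (b i) => z; exists z.
  exists [seq val (z i) | i <- enum 'I_m]; split.
  - by rewrite size_map size_enum_ord.
  - by move=> _ /mapP[i _ ->]; apply/cycleP/valP.
  move=> x /cycleP xZ; have [c] := bspan (cl (Sub x xZ)).
  under eq_bigr => i _ do rewrite zE.
  have -> : \sum_i c i *: cl (z i) = cl (\sum_i c i *: z i).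
    elim/big_rec2: _ => [|i y y' _ ->]; last by rewrite clL.
    by rewrite /cl; symmetry; apply: (linear0 (quotmod_pi (V:=cycles X j) _)).
  move/clP; rewrite SubK => bx.
  pose y := \sum_i c i *: z i.
  rewrite -(subrK (val y) x); apply: (subspaceD (subspace_span _ hB)).
    exact: span_base.
  rewrite /y raddf_sum /=; apply: (subspace_sum (subspace_span _ hB)) => i _.
  apply: (subspaceZ (subspace_span _ hB)); apply: span_mem => //.
  by apply/mapP; exists i; rewrite ?mem_enum.
(* [insubd] sends a vector that is not a cycle to 0; the vectors of s are cycles, so f takes each of
   them to its class. *)
pose f x := cl (insubd 0 x).
have fE z : f (val z) = cl z by rewrite /f valKd.
have cl0 : cl 0 = 0.
  by apply: (addIr (cl 0)); rewrite add0r -{1}[cl 0]scale1r -clL scaler0 addr0.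
apply: (dimE_le R (s := [seq f x | x <- s])); first by rewrite size_map.
elim/quotmod_ind => z; rewrite -/(cl z).
have := sspan _ (elimT (cycleP _) (valP z)); clear sspan sn.
elim: s sZ z => [|x s IHs] sZ z /=.
  move=> bz; rewrite -cl0; apply/clP.
  by have -> : val (0 : cycles X j) = 0 by []; rewrite subr0.
have xZ : x \in cycle_pred (X := X) (j := j).
  by apply/cycleP/sZ; rewrite mem_head.
case=> c; pose x0 : cycles X j := Sub x xZ; rewrite -[x]/(val x0).
have -> : val z - c *: val x0 = val (z - c *: x0) by [].
rewrite fE => h; exists c.
have -> : cl z - c *: cl x0 = cl (z - c *: x0).
  by rewrite addrC -scaleNr -clL scaleNr addrC.
by apply: IHs h => y ys; apply: sZ; rewrite inE ys orbT.
Qed.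

End HomologyDim.

(** * Comparing dimensions of subquotients *)

Section DimLe.
Variable F : fieldType.

(** Each [psi i z] is a combination of s modulo B, and [phi i] carries this combination over; hence
    the images of s under all [phi i] span. Only the [phi i] have to be linear and to respect
    boundaries. *)
Lemma dim_le_retract (V V' : lmodType F) (Z B : V -> Prop) (Z' B' : V' -> Prop)
    (I : eqType) (r : seq I) (phi : I -> {linear V -> V'})
    (psi : I -> V' -> V) n :
  subspace B' -> (forall i z, Z z -> Z' (phi i z)) ->
  (forall i z, B z -> B' (phi i z)) -> (forall i z, Z' z -> Z (psi i z)) ->
  (forall z, Z' z -> z = \sum_(i <- r) phi i (psi i z)) ->
  dim_le Z B n -> dim_le Z' B' (size r * n).
Proof.
move=> hB' ZZ' BB' Z'Z id [s [sn sZ sspan]].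
exists [seq phi i x | i <- r, x <- s]; split.
- by rewrite size_allpairs leq_mul2l sn orbT.
- by move=> _ /allpairsP[[i x] [_ /= /sZ xZ ->]]; apply: ZZ'.
move=> z zZ; rewrite (id z zZ).
have hS := subspace_span [seq phi i x | i <- r, x <- s] hB'.
apply: (subspace_sum hS) => i ir.
have := span_map (BB' i) (sspan _ (Z'Z i z zZ)).
apply: (span_min hS) => [v|v /mapP[x xs ->]]; first exact: span_base.
by apply: span_mem => //; apply: allpairs_f.
Qed.

(* The middle term of an exact sequence [ZY/BY -> ZC/BC -> ZX/BX]. *)
Lemma dim_le_exact (VY VC VX : lmodType F) (ZY BY : VY -> Prop)
    (ZC BC : VC -> Prop) (ZX BX : VX -> Prop)
    (i : {linear VY -> VC}) (p : {linear VC -> VX}) a b :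
  subspace ZC -> subspace BC -> subspace BX ->
  (forall y, ZY y -> ZC (i y)) -> (forall y, BY y -> BC (i y)) ->
  (forall c, ZC c -> ZX (p c)) ->
  (forall c, ZC c -> BX (p c) -> exists2 y, ZY y & BC (c - i y)) ->
  dim_le ZY BY a -> dim_le ZX BX b -> dim_le ZC BC (b + a).
Proof.
move=> hZC hBC hBX iZ iB pZ exct [sY [sYa sYZ sYspan]] [sX [sXb _ sXspan]].
(* The given generators of ZX modulo BX need not lift to ZC. [span_subspace] replaces them by no
   more generators of the image of ZC, and these do lift. *)
have hW : subspace (fun x => exists2 c, ZC c & x = p c).
  split=> [|k _ _ [c cZ ->] [c' cZ' ->]].
    by exists 0; [exact: subspace0|rewrite linear0].
  by exists (k *: c + c'); [exact: subspaceP|rewrite linearP].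
have [w [c cZ ->]|t [tle tW tspan]] := span_subspace (s := sX) hBX hW.
  exact/sXspan/pZ.
have [ct ctZ tE] :
    exists2 ct, forall c, c \in ct -> ZC c & t = [seq p c | c <- ct].
  elim: t tW {tle tspan} => [|x t IHt] tW; first by exists [::].
  have [c cZ ->] := tW x (mem_head _ _).
  have [|ct ctZ ->] := IHt.
    by move=> w wt; apply: tW; rewrite inE wt orbT.
  by exists (c :: ct) => // d; rewrite inE => /orP[/eqP->|/ctZ].
exists (ct ++ [seq i y | y <- sY]); split.
- rewrite size_cat size_map leq_add//; apply: leq_trans sXb.
  by move: tle; rewrite tE size_map.
- by move=> c; rewrite mem_cat => /orP[/ctZ//|/mapP[y /sYZ yZ ->]]; apply: iZ.
move=> z zZ; have : span BX [seq p c | c <- ct] (p z).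
  by rewrite -tE; apply: tspan; exists z.
(* Multiples of the lifts are subtracted from z until [p z] lies in BX, where exactness applies. *)
elim: ct ctZ z zZ {tE} => [|c ct IHct] ctZ z zZ /=.
  case/(exct z zZ) => y yZ zy; rewrite -(subrK (i y) z).
  have hS := subspace_span [seq i y | y <- sY] hBC.
  apply: (subspaceD hS); first exact: span_base.
  exact: span_map (sYspan y yZ).
case=> k; rewrite -linearZ -linearB => h; exists k; apply: IHct h.
  by move=> d dct; apply: ctZ; rewrite inE dct orbT.
apply: (subspaceB hZC) (subspaceZ hZC k _) => //.
by apply: ctZ; rewrite mem_head.
Qed.

End DimLe.

Section DimEBounds.
Variables (R : realType) (F : fieldType).
Local Open Scope ereal_scope.

Lemma dimE_leW (V W : lmodType F) :
  (forall n, dimE R V <= n%:R%:E -> dimE R W <= n%:R%:E) ->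
  dimE R W <= dimE R V.
Proof.
have [->|[n [b [_ ->]]]] := dimE_basis R V; first by rewrite leey.
exact.
Qed.

Lemma dimE_le_add (U V W : lmodType F) :
  (forall a b, dimE R U <= a%:R%:E -> dimE R V <= b%:R%:E ->
               dimE R W <= (b + a)%:R%:E) ->
  dimE R W <= dimE R V + dimE R U.
Proof.
move=> h; have := h; have := dimE_ge0 R U; have := dimE_ge0 R V.
have [->|[n [b [_ ->]]]] := dimE_basis R U.
  by move=> V0 _ _; rewrite addey ?leey// gt_eqF// (lt_le_trans _ V0) ?ltNy0.
have [->|[m [b' [_ ->]]]] := dimE_basis R V; first by rewrite addye ?leey.
by move=> _ _ /(_ n m); rewrite natrD EFinD; apply.
Qed.

(** Meant for m copies of a complex for a subgroup, with N and N' the indices in the subgroup and in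
    the group: the bound follows from [m / N' <= 1 / N]. *)
Lemma dimE_div_le (V W : lmodType F) (m N N' : nat) :
  (0 < N)%N -> (0 < N')%N -> (m * N <= N')%N ->
  (forall n, dimE R V <= n%:R%:E -> dimE R W <= (m * n)%:R%:E) ->
  dimE R W / N'%:R%:E <= dimE R V / N%:R%:E.
Proof.
move=> N0 N'0 le h; rewrite !inver !pnatr_eq0 !gtn_eqF//.
rewrite lee_pdivrMr ?ltr0n// -muleA -EFinM.
(* Positivity of this factor makes its product with an infinite dimension [+oo] rather than 0. *)
have r0 : (0 < N%:R^-1 * N'%:R :> R)%R by rewrite mulr_gt0 ?invr_gt0 ?ltr0n.
have [->|[n [b [_ nE]]]] := dimE_basis R V; first by rewrite gt0_mulye ?leey.
rewrite nE; apply: (le_trans (h n _)); first by rewrite nE.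
rewrite -EFinM lee_fin natrM mulrC ler_wpM2l ?ler0n//.
by rewrite mulrC ler_pdivlMr ?ltr0n// -natrM ler_nat.
Qed.
End DimEBounds.

(** * Nonnegative sequences with vanishing limit superior *)

Section LimSup.
Variable R : realType.
Implicit Types u v : nat -> \bar R.
Local Open Scope ereal_scope.

(** Nonnegativity squeezes the lower limit as well; squeezing and addition of limits thereby become
    available. *)
Lemma limn_esup_eq0 u : (forall i, 0 <= u i) ->
  limn_esup u = 0 <-> (u i @[i --> \oo] --> (0 : \bar R))%classic.
Proof.
move=> u0; split=> [uE|/cvg_limn_einf_sup[]//].
by apply: limn_esup_le_cvg => //; rewrite uE.
Qed.

Lemma limn_esup_eq0_le u v : (forall i, 0 <= u i <= v i) ->
  limn_esup v = 0 -> limn_esup u = 0.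
Proof.
move=> uv; have u0 i : 0 <= u i by case/andP: (uv i).
have v0 i : 0 <= v i by case/andP: (uv i); apply: le_trans.
move=> /(limn_esup_eq0 v0) cv; apply/(limn_esup_eq0 u0).
have c0 : ((fun=> 0 : \bar R) i @[i --> \oo] --> (0 : \bar R))%classic.
  exact: cvg_cst.
apply: (squeeze_cvge _ c0 cv); by apply: nearW => i; apply: uv.
Qed.

Lemma limn_esup_eq0D u v : (forall i, 0 <= u i) -> (forall i, 0 <= v i) ->
  limn_esup u = 0 -> limn_esup v = 0 -> limn_esup (fun i => u i + v i) = 0.
Proof.
move=> u0 v0 /(limn_esup_eq0 u0) cu /(limn_esup_eq0 v0) cv.
apply/limn_esup_eq0 => [i|]; first exact: adde_ge0.
by rewrite -[X in (_ --> X)%classic](adde0 0); apply: cvgeD.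
Qed.

End LimSup.

(** * Coinvariants with coefficients in a field *)

Section Coinv.
Variables (F : fieldType) (G : groupType) (L : groupClosed G).
Implicit Types M N : lmodType (groupring G).

(* The value in one degree of [base_change F (coinvariants L X)], namely
   [F (x)_Z (Z (x)_{ZL} M)]. *)
Definition coinv M : lmodType F :=
  extend (intmul 1 : {rmorphism int -> F})
    (extend (augmentation (subgrp L)) (restrict (subgrp_incl L) M)).

Definition coinv_pi M (m : M) : coinv M :=
  etens (intmul 1 : {rmorphism int -> F}) 1
    (etens (augmentation (subgrp L)) 1 (m : restrict (subgrp_incl L) M)).

Lemma coinv_piD M (m m' : M) : coinv_pi (m + m') = coinv_pi m + coinv_pi m'.
Proof. by rewrite /coinv_pi etensDr etensDr. Qed.

Lemma coinv_pi0 M : coinv_pi (0 : M) = 0.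
Proof. by rewrite /coinv_pi !etens0. Qed.

Lemma augmentationU (H : groupType) (h : H) : augmentation H << h >> = 1.
Proof. exact: mliftU1. Qed.

Lemma subgrp_inclU (h : subgrp L) :
  subgrp_incl L << h >> = << val h >> :> groupring G.
Proof. exact: mliftU1. Qed.

Lemma coinv_pi_inv M (g : G) (m : M) : g \in L ->
  coinv_pi ((<< g >> : groupring G) *: m) = coinv_pi m.
Proof.
move=> gL; pose h : subgrp L := Sub g gL.
rewrite /coinv_pi.
have -> : (<< g >> : groupring G) *: m =
    (<< h >> : groupring (subgrp L)) *: (m : restrict (subgrp_incl L) M).
  by rewrite -[RHS]/(subgrp_incl L << h >> *: m) subgrp_inclU.
by rewrite -etensM augmentationU mulr1.
Qed.

(** In a nested pure tensor the integer entry moves across into F, which leaves a scalar multiple of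
    some [coinv_pi m]; so these elements span over F. *)
Lemma coinv_ind M (P : coinv M -> Prop) : subspace P ->
  (forall m, P (coinv_pi m)) -> forall t, P t.
Proof.
move=> hP Ppi; elim/ext_ind => [|t t' Pt Pt'|a w].
- exact: subspace0.
- exact: subspaceB.
have -> : etens (intmul 1 : {rmorphism int -> F}) a w =
    a *: (etens (intmul 1 : {rmorphism int -> F}) 1 w : coinv M).
  by rewrite etensZ mulr1.
apply: (subspaceZ hP).
elim/ext_ind: w => [|w w' Pw Pw'|z m].
- by rewrite etens0; exact: subspace0.
(* The sign becomes an integer scalar so that it can cross the tensor product into F. *)
- have -> : w - w' = w + (-1 : int) *: w' by rewrite scaleN1r.
  rewrite etensDr -etensM mul1r rmorphN1 -[-1 : F]mulr1 -etensZ scaleN1r.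
  exact: subspaceB.
have -> : etens (augmentation (subgrp L)) z m =
    z *: etens (augmentation (subgrp L)) 1 m by rewrite etensZ mulr1.
rewrite -etensM mul1r -[X in etens _ X _]mulr1 -etensZ.
by apply: (subspaceZ hP); apply: Ppi.
Qed.

(** Two linear maps agree on a subspace. Linearity is a plain hypothesis so that composites and sums
    can be compared without bundling them. *)
Lemma coinv_eq M (V : lmodType F) (f f' : coinv M -> V) :
  linear f -> linear f' ->
  (forall m, f (coinv_pi m) = f' (coinv_pi m)) -> f =1 f'.
Proof.
move=> lf lf'; have z (h : coinv M -> V) : linear h -> h 0 = 0.
  move=> lh; have := lh 1 0 0; rewrite !scale1r addr0 => /esym/eqP.
  by rewrite -subr_eq0 addrK => /eqP.
apply: coinv_ind; split=> [|a u v hu hv]; first by rewrite !z.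
by rewrite lf lf' hu hv.
Qed.

Section Lift.
Variables (M : lmodType (groupring G)) (V : lmodType F) (b : M -> V).
Hypotheses (bD : {morph b : m m' / m + m'})
  (bL : forall g m, g \in L -> b ((<< g >> : groupring G) *: m) = b m).

Let b0 : b 0 = 0.
Proof. by apply: (addIr (b 0)); rewrite -bD !add0r. Qed.

Let bB m m' : b (m - m') = b m - b m'.
Proof. by apply: (addIr (b m')); rewrite -bD !subrK. Qed.

Let beta (z : int) (m : restrict (subgrp_incl L) M) : V := b m *~ z.

(** By additivity r may be a group element h; its augmentation is 1, and b is invariant under h. *)
Let beta_bal z (r : groupring (subgrp L)) (m : restrict (subgrp_incl L) M) :
  beta (z * augmentation (subgrp L) r) m = beta z (r *: m).
Proof.
rewrite /beta mulrC mulrzA; congr (_ *~ _).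
elim/malg_ind: r => [|x y hx hy|h].
- by rewrite [augmentation _ _]raddf0 mulr0z scale0r b0.
- by rewrite [augmentation _ _]raddfB mulrzBr scalerBl bB hx hy.
rewrite augmentationU mulr1z -[RHS]/(b (subgrp_incl L << h >> *: (m : M))).
by rewrite subgrp_inclU bL// (valP h).
Qed.

(* The lifts are sealed because conversion otherwise unfolds the tensor
   products during rewriting. *)
Let lift1_sig : {f : {additive
    extend (augmentation (subgrp L)) (restrict (subgrp_incl L) M) -> V} |
  forall z m, f (etens (augmentation (subgrp L)) z m) = b m *~ z}.
Proof.
have betaDl z z' m : beta (z + z') m = beta z m + beta z' m.
  by rewrite /beta mulrzDr.
have betaDr z m m' : beta z (m + m') = beta z m + beta z m'.
  by rewrite /beta bD mulrzDl.
exists (tensor_lift (M := ring_rmod (augmentation (subgrp L)))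
  betaDl betaDr beta_bal).
by move=> z m; exact: tensor_liftE.
Qed.

Let lift1 := sval lift1_sig.

Let lift2_sig : {f : {additive coinv M -> V} | forall a w,
  f (etens (intmul 1 : {rmorphism int -> F}) a w) = a *: lift1 w}.
Proof.
pose g (a : F) w := a *: lift1 w.
have gDl a a' w : g (a + a') w = g a w + g a' w by rewrite /g scalerDl.
have gDr a w w' : g a (w + w') = g a w + g a w' by rewrite /g raddfD scalerDr.
have gM a (z : int) w : g (a * z%:~R) w = g a (z *: w).
  rewrite /g -scalerA; congr (_ *: _).
  by rewrite scaler_int -[z in RHS]intz scaler_int raddfMz.
exists (tensor_lift (M := ring_rmod (intmul 1 : {rmorphism int -> F}))
  gDl gDr gM).
by move=> a w; exact: tensor_liftE.
Qed.

Let lift2 := sval lift2_sig.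

Let lift2E a w :
  lift2 (etens (intmul 1 : {rmorphism int -> F}) a w) = a *: lift1 w.
Proof. exact: svalP lift2_sig a w. Qed.

Let lift2_linear : linear lift2.
Proof.
move=> a t t'; rewrite raddfD; congr (_ + _).
elim/ext_ind: t => [|u v hu hv|x w]; first by rewrite scaler0 !raddf0.
  by rewrite scalerBr !raddfB hu hv.
transitivity (lift2 (etens (intmul 1 : {rmorphism int -> F}) (a * x) w)).
  by congr (lift2 _); apply: etensZ.
apply: (etrans (lift2E (a * x) w)); apply: (etrans (esym (scalerA _ _ _))).
exact: (congr1 ( *:%R a) (esym (lift2E x w))).
Qed.

(** The universal property of coinvariants. An additive invariant b suffices, because the scalars of
    F enter through the outer tensor factor. *)
Definition coinv_lift : {linear coinv M -> V} :=
  HB.pack_for {linear coinv M -> V} (lift2 : coinv M -> V)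
    (GRing.isLinear.Build F (coinv M) V *:%R lift2 lift2_linear).

Lemma coinv_liftE m : coinv_lift (coinv_pi m) = b m.
Proof.
by rewrite -[LHS]/(lift2 (coinv_pi m)) lift2E scale1r (svalP lift1_sig) mulr1z.
Qed.

End Lift.

Section Map.
Variables (M N : lmodType (groupring G)) (f : {linear M -> N}).

Definition coinv_map : {linear coinv M -> coinv N} :=
  extend_map (intmul 1 : {rmorphism int -> F})
    (extend_map (augmentation (subgrp L)) (restrict_map (subgrp_incl L) f)).

Lemma coinv_mapE m : coinv_map (coinv_pi m) = coinv_pi (f m).
Proof. by rewrite /coinv_map /coinv_pi !extend_mapE. Qed.

End Map.

End Coinv.

Section CoinvMaps.
Variables (F : fieldType) (G : groupType) (L : groupClosed G).
Implicit Types M N : lmodType (groupring G).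

Lemma coinv_map_square M N N' M' (f : {linear N -> M'}) (g : {linear M -> N})
    (f' : {linear N' -> M'}) (g' : {linear M -> N'}) (t : coinv F L M) :
  (forall m, f (g m) = f' (g' m)) ->
  coinv_map F L f (coinv_map F L g t) = coinv_map F L f' (coinv_map F L g' t).
Proof.
move=> fg; apply: (coinv_eq (f := fun t => coinv_map F L f (coinv_map F L g t))
  (f' := fun t => coinv_map F L f' (coinv_map F L g' t))).
- by move=> a u v; rewrite !linearP.
- by move=> a u v; rewrite !linearP.
by move=> m; rewrite !coinv_mapE fg.
Qed.

Lemma coinv_mapK M N (f : {linear N -> M}) (g : {linear M -> N})
    (t : coinv F L M) :
  cancel g f -> coinv_map F L f (coinv_map F L g t) = t.
Proof.
move=> fg; apply: (coinv_eq (f := fun t => coinv_map F L f (coinv_map F L g t))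
  (f' := fun t => t)) => //.
- by move=> a u v; rewrite !linearP.
by move=> m; rewrite !coinv_mapE fg.
Qed.

Lemma coinv_map_comp0 M N N' (f : {linear N -> N'}) (g : {linear M -> N})
    (t : coinv F L M) :
  (forall m, f (g m) = 0) -> coinv_map F L f (coinv_map F L g t) = 0.
Proof.
move=> fg; apply: (coinv_eq (f := fun t => coinv_map F L f (coinv_map F L g t))
  (f' := fun=> 0)).
- by move=> a u v; rewrite !linearP.
- by move=> a u v; rewrite scaler0 addr0.
by move=> m; rewrite !coinv_mapE fg coinv_pi0.
Qed.

End CoinvMaps.

(** * Homology of coinvariants *)

Section CoinvHomology.
Variables (R : realType) (F : fieldType) (G : groupType) (L : groupClosed G).
Implicit Types X Y : chain_complex (groupring G).

Definition coinv_cycle X j (t : coinv F L (X j)) : Prop :=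
  coinv_map F L (cc_d X j) t = 0.

Definition coinv_boundary X k (t : coinv F L (X (k - 1))) : Prop :=
  exists u : coinv F L (X k), t = coinv_map F L (cc_d X k) u.

(** Replaces the homology of the nested tensor complex by conditions on [coinv_map] of the original
    differentials, so that later arguments can be checked on the elements [coinv_pi m]. *)
Lemma coinv_homology_dim_le X k n :
  (dimE R (homology (base_change F (coinvariants L X)) (k - 1)) <= n%:R%:E)%E
  <-> dim_le (@coinv_cycle X (k - 1)) (@coinv_boundary X k) n.
Proof.
rewrite homology_dim_le.
suff -> : @coinv_boundary X k =
    @boundary _ (base_change F (coinvariants L X)) (k - 1) by [].
apply/funext => t; apply/propext.
by rewrite (@boundaryE _ (base_change F (coinvariants L X)) k t).
Qed.

Lemma subspace_coinv_cycle X j : subspace (@coinv_cycle X j).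
Proof.
split=> [|a u v du dv]; first exact: linear0.
by rewrite /coinv_cycle linearP du dv scaler0 addr0.
Qed.

Lemma subspace_coinv_boundary X k : subspace (@coinv_boundary X k).
Proof.
split=> [|a u v [x ->] [y ->]]; first by exists 0; rewrite linear0.
by exists (a *: x + y); rewrite linearP.
Qed.

Lemma coinv_homology_deg X j : j < 0 -> concentrated_ge 0 X ->
  dimE R (homology (base_change F (coinvariants L X)) j) = 0%E.
Proof.
elim/int_pred_ind: j => k k0 hX; apply/eqP; rewrite eq_le dimE_ge0 andbT.
apply/(coinv_homology_dim_le X k 0).
exists [::]; split=> // t _ /=.
apply: (coinv_ind (subspace_coinv_boundary X k)) => m.
rewrite (hX _ k0 m) coinv_pi0; exact: subspace0 (subspace_coinv_boundary X k).
Qed.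

Lemma coinv_homology_iso X Y j : cc_iso X Y ->
  (dimE R (homology (base_change F (coinvariants L Y)) j) <=
   dimE R (homology (base_change F (coinvariants L X)) j))%E.
Proof.
case=> f fbij; elim/int_pred_ind: j => k.
(* Bijectivity only provides an inverse function in each degree; it has to be made linear before
   [coinv_map] applies to it. *)
have gex i :
    exists g : {linear Y i -> X i}, cancel (f i) g /\ cancel g (f i).
  have [g fK gK] := fbij i.
  have lg : linear g.
    by move=> a u v; apply: (can_inj fK); rewrite linearP !gK.
  by exists (HB.pack_for {linear Y i -> X i} g
    (GRing.isLinear.Build _ _ _ _ g lg)).
pose g i := projT1 (cid (gex i)).
have gK i : cancel (f i) (g i) /\ cancel (g i) (f i) := projT2 (cid (gex i)).
apply: dimE_leW => n.
rewrite (coinv_homology_dim_le X) (coinv_homology_dim_le Y).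
move=> h; rewrite -(mul1n n); move: h.
(* An isomorphism is the case of a single summand. *)
apply: (@dim_le_retract F _ _ _ _ _ _ unit [:: tt]
  (fun=> coinv_map F L (f (k - 1))) (fun=> coinv_map F L (g (k - 1)))).
- exact: subspace_coinv_boundary.
- move=> _ t tZ; rewrite /coinv_cycle.
  rewrite (coinv_map_square (f' := f (k - 1 - 1)) (g' := cc_d X (k - 1))).
    by rewrite tZ linear0.
  by move=> m; rewrite cm_comm.
- move=> _ _ [t ->]; exists (coinv_map F L (f k) t).
  by apply: coinv_map_square => m; rewrite cm_comm.
- move=> _ t tZ; rewrite /coinv_cycle.
  rewrite (coinv_map_square (f' := g (k - 1 - 1)) (g' := cc_d Y (k - 1))).
    by rewrite tZ linear0.
  move=> m; apply: (can_inj (gK (k-1-1)).1); rewrite (gK _).2 cm_comm.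
  by rewrite (gK _).2.
by move=> t _; rewrite big_seq1 coinv_mapK//; exact: (gK (k - 1)).2.
Qed.

(** Changing the sign of a differential alters neither its kernel nor its image. *)
Lemma coinv_homology_susp X k :
  dimE R (homology (base_change F (coinvariants L (susp X))) (k - 1)) =
  dimE R (homology (base_change F (coinvariants L X)) (k - 1 - 1)).
Proof.
have dN j t :
    coinv_map F L (cc_d (susp X) j) t = - coinv_map F L (cc_d X (j - 1)) t.
  apply: (coinv_eq (f' := fun t => - coinv_map F L (cc_d X (j - 1)) t)).
  - by move=> a u v; rewrite linearP.
  - by move=> a u v; rewrite linearP opprD scalerN.
  move=> m; rewrite !coinv_mapE; apply/eqP; rewrite -addr_eq0 -coinv_piD.
  by rewrite /= addNr coinv_pi0.
have ZE : @coinv_cycle (susp X) (k - 1) = @coinv_cycle X (k - 1 - 1).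
  apply/funext => t; apply/propext; rewrite /coinv_cycle dN.
  by split=> [/eqP|->]; rewrite ?oppr0// oppr_eq0 => /eqP.
have BE : @coinv_boundary (susp X) k = @coinv_boundary X (k - 1).
  apply/funext => t; apply/propext.
  have dN' (u : coinv F L (X (k - 1))) :
      coinv_map F L (cc_d X (k - 1)) (- u) = - coinv_map F L (cc_d X (k - 1)) u.
    by rewrite linearN.
  split=> -[u ->]; exists (- u); first exact: etrans (dN k u) (esym (dN' u)).
  by rewrite (dN k (- u)) dN' opprK.
have dimE_iff n :
  (dimE R (homology (base_change F (coinvariants L (susp X))) (k - 1))
     <= n%:R%:E)%E <->
  (dimE R (homology (base_change F (coinvariants L X)) (k - 1 - 1))
     <= n%:R%:E)%E.
  have hS := coinv_homology_dim_le (susp X) k n.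
  have hX := coinv_homology_dim_le X (k - 1) n.
  rewrite ZE BE in hS; exact: iff_trans hS (iff_sym hX).
apply/eqP; rewrite eq_le; apply/andP; split.
  by apply: dimE_leW => n; exact: (proj2 (dimE_iff n)).
by apply: dimE_leW => n; exact: (proj1 (dimE_iff n)).
Qed.

End CoinvHomology.

(** * Mapping cones *)

Section Cone.
Variables (R : realType) (F : fieldType) (G : groupType) (L : groupClosed G).
Variables (X Y : chain_complex (groupring G)) (f : chain_map X Y).

Definition cone_inl_fun j (x : X (j - 1)) : cone f j := (x, 0).

Fact cone_inl_is_linear j : linear (@cone_inl_fun j).
Proof. by move=> a x x'; congr (_, _); rewrite /= scaler0 addr0. Qed.
HB.instance Definition _ j := GRing.isLinear.Build (groupring G) (X (j - 1))
  (cone f j) *:%R (@cone_inl_fun j) (@cone_inl_is_linear j).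

Definition cone_inr_fun j (y : Y j) : cone f j := (0, y).

Fact cone_inr_is_linear j : linear (@cone_inr_fun j).
Proof. by move=> a x x'; congr (_, _); rewrite /= scaler0 addr0. Qed.
HB.instance Definition _ j := GRing.isLinear.Build (groupring G) (Y j)
  (cone f j) *:%R (@cone_inr_fun j) (@cone_inr_is_linear j).

Definition cone_fst j : {linear cone f j -> X (j - 1)} := fst.
Definition cone_snd j : {linear cone f j -> Y j} := snd.


Definition cone_inl j : {linear X (j - 1) -> cone f j} := @cone_inl_fun j.
Definition cone_inr j : {linear Y j -> cone f j} := @cone_inr_fun j.

Lemma coinv_cone_split j (z : coinv F L (cone f j)) :
  z = coinv_map F L (cone_inl j) (coinv_map F L (cone_fst j) z)
      + coinv_map F L (cone_inr j) (coinv_map F L (cone_snd j) z).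
Proof.
apply: (coinv_eq (f := id) (f' := fun z =>
  coinv_map F L (cone_inl j) (coinv_map F L (cone_fst j) z)
  + coinv_map F L (cone_inr j) (coinv_map F L (cone_snd j) z))) => //.
- by move=> a u v; rewrite !linearP scalerDr addrACA.
move=> [x y]; rewrite !coinv_mapE -coinv_piD; congr coinv_pi.
by congr (_, _); rewrite /= ?addr0 ?add0r.
Qed.

(** The inclusion of X is not compatible with the differentials; the term in f is what corrects a
    cycle of the cone in the proof of exactness. *)
Lemma coinv_cone_d_inl j (x : coinv F L (X (j - 1))) :
  coinv_map F L (cc_d (cone f) j) (coinv_map F L (cone_inl j) x) =
  coinv_map F L (cone_inr (j - 1)) (coinv_map F L (f (j - 1)) x)
  - coinv_map F L (cone_inl (j - 1)) (coinv_map F L (cc_d X (j - 1)) x).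
Proof.
apply: (coinv_eq
  (f := fun x => coinv_map F L (cc_d (cone f) j) (coinv_map F L (cone_inl j) x))
  (f' := fun x => coinv_map F L (cone_inr (j - 1)) (coinv_map F L (f (j - 1)) x)
  - coinv_map F L (cone_inl (j - 1)) (coinv_map F L (cc_d X (j - 1)) x))).
- by move=> a u v; rewrite !linearP.
- by move=> a u v; rewrite !linearP addrACA -scalerDr.
move=> {}x; rewrite !coinv_mapE; apply: (canRL (addrK _)).
rewrite -coinv_piD; congr coinv_pi; congr (_, _) => /=.
  by rewrite addNr.
by rewrite linear0 add0r addr0.
Qed.

Lemma coinv_homology_cone k :
  (dimE R (homology (base_change F (coinvariants L (cone f))) (k - 1)) <=
   dimE R (homology (base_change F (coinvariants L X)) (k - 1 - 1)) +
   dimE R (homology (base_change F (coinvariants L Y)) (k - 1)))%E.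
Proof.
apply: dimE_le_add => a b.
move=> /(proj1 (coinv_homology_dim_le R F L Y k a)) hY.
move=> /(proj1 (coinv_homology_dim_le R F L X (k - 1) b)) hX.
apply: (proj2 (coinv_homology_dim_le R F L (cone f) k (b + a))).
have dinr j (y : coinv F L (Y j)) :
    coinv_map F L (cc_d (cone f) j) (coinv_map F L (cone_inr j) y) =
    coinv_map F L (cone_inr (j - 1)) (coinv_map F L (cc_d Y j) y).
  apply: coinv_map_square => m; congr (_, _); rewrite /= linear0 ?oppr0//.
  by rewrite addr0.
have dfst j (z : coinv F L (cone f j)) :
    coinv_map F L (cone_fst (j - 1)) (coinv_map F L (cc_d (cone f) j) z) =
    - coinv_map F L (cc_d X (j - 1)) (coinv_map F L (cone_fst j) z).
  apply: (coinv_eq (f := fun z =>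
    coinv_map F L (cone_fst (j - 1)) (coinv_map F L (cc_d (cone f) j) z))
    (f' := fun z =>
    - coinv_map F L (cc_d X (j - 1)) (coinv_map F L (cone_fst j) z))).
  - by move=> c u v; rewrite !linearP.
  - by move=> c u v; rewrite !linearP.
  move=> m; rewrite !coinv_mapE; apply/eqP; rewrite -addr_eq0 -coinv_piD.
  by rewrite /= addNr coinv_pi0.
apply: (dim_le_exact (i := coinv_map F L (cone_inr (k - 1)))
  (p := coinv_map F L (cone_fst (k - 1))) _ _ _ _ _ _ _ hY hX).
- exact: subspace_coinv_cycle.
- exact: subspace_coinv_boundary.
- exact: subspace_coinv_boundary.
- by move=> y yZ; rewrite /coinv_cycle dinr yZ linear0.
- by move=> _ [y ->]; exists (coinv_map F L (cone_inr k) y); rewrite dinr.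
- move=> z zZ; rewrite /coinv_cycle; apply: oppr_inj.
  by rewrite oppr0 -dfst zZ linear0.
move=> z zZ [x pz].
(* The X-component of z is the boundary of x. Subtracting from z the boundary of [(- x, 0)] removes
   this component and adds the image of x under f to the Y-component. *)
pose y := coinv_map F L (cone_snd (k - 1)) z + coinv_map F L (f (k - 1)) x.
have iyE : z - coinv_map F L (cone_inr (k - 1)) y =
    coinv_map F L (cc_d (cone f) k) (- coinv_map F L (cone_inl k) x).
  rewrite linearN coinv_cone_d_inl opprB /y linearD -pz opprD addrA.
  by rewrite {1}[z]coinv_cone_split addrK.
exists y; last by exists (- coinv_map F L (cone_inl k) x).
have {}iyE : coinv_map F L (cone_inr (k - 1)) y =
    z - coinv_map F L (cc_d (cone f) k) (- coinv_map F L (cone_inl k) x).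
  by rewrite -iyE subKr.
rewrite /coinv_cycle.
(* That y is a cycle can be tested after the inclusion of Y, which has a left inverse; there y is z
   minus a boundary. *)
rewrite -[LHS](coinv_mapK (f := cone_snd (k - 1 - 1))
  (g := cone_inr (k - 1 - 1)))//.
rewrite -dinr iyE linearB zZ.
have -> : coinv_map F L (cc_d (cone f) (k - 1))
    (coinv_map F L (cc_d (cone f) k) (- coinv_map F L (cone_inl k) x)) = 0.
  by apply: coinv_map_comp0 => m; exact: cc_dd.
by rewrite subr0 linear0.
Qed.

End Cone.

(** * Cosets *)

Section SubgroupPreimage.
Variables (G : groupType) (D L : groupClosed G).

Definition subgrp_preim_pred : {pred subgrp D} := fun x => val x \in L.

Fact subgrp_preim_mul : mulg_closed subgrp_preim_pred.
Proof. by move=> x y xL yL; exact: (gpredM (val x) (val y) xL yL). Qed.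
Fact subgrp_preim_one : (1 : subgrp D)%g \in subgrp_preim_pred.
Proof. exact: (gpred1 (s := L)). Qed.
Fact subgrp_preim_inv : invg_closed subgrp_preim_pred.
Proof. by move=> x xL; exact: (gpredVr (val x) xL). Qed.
HB.instance Definition _ :=
  isMulClosed.Build _ subgrp_preim_pred subgrp_preim_mul.
HB.instance Definition _ :=
  isMul1Closed.Build _ subgrp_preim_pred subgrp_preim_one.
HB.instance Definition _ :=
  isInvClosed.Build _ subgrp_preim_pred subgrp_preim_inv.

Definition subgrp_preim : groupClosed (subgrp D) := subgrp_preim_pred.

Lemma mem_subgrp_preim x : (x \in subgrp_preim) = (val x \in L).
Proof. by []. Qed.

End SubgroupPreimage.

Section Cosets.
Variables (G : groupType) (S : groupClosed G).
Implicit Types (g h : G) (s : seq G).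
Local Open Scope group_scope.

Definition lcoset_of g : set G := [set x | g^-1 * x \in S]%classic.

Lemma lcoset_ofP g h : lcoset_of g = lcoset_of h <-> g^-1 * h \in S.
Proof.
split=> [e|gh].
  have : lcoset_of h h by rewrite /lcoset_of /= mulVg gpred1.
  by rewrite -e.
apply/funext => x; apply/propext; rewrite /lcoset_of /=.
have -> : g^-1 * x = (g^-1 * h) * (h^-1 * x) by rewrite mulgA mulgK.
by rewrite gpredMl.
Qed.

Lemma lcosets_ofE : lcosets_of S = range lcoset_of.
Proof. by apply/seteqP; split=> [C [g ->]|C [g _ <-]]; exists g. Qed.

Lemma finite_index_cover s : (forall g, exists2 h, h \in s & h^-1 * g \in S) ->
  finite_index S.
Proof.
move=> cov; apply: (@sub_finite_set _ _ (lcoset_of @` [set` s])%classic).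
  rewrite lcosets_ofE => C [g _ <-]; have [h hs hg] := cov g.
  by exists h => //; apply/lcoset_ofP.
by apply: finite_image; exact: finite_seq.
Qed.

Hypothesis Sfin : finite_index S.

Lemma size_le_index s : uniq s ->
  {in s &, forall g h, g^-1 * h \in S -> g = h} -> (size s <= index_of S)%N.
Proof.
move=> us inj; rewrite /index_of -(size_map lcoset_of); apply: uniq_leq_size.
  rewrite map_inj_in_uniq// => g h gs hs /lcoset_ofP; exact: inj.
move=> _ /mapP[g _ ->]; rewrite in_fset_set// inE lcosets_ofE.
by exists g.
Qed.

Lemma index_reps : exists s, [/\ uniq s, size s = index_of S,
  {in s &, forall g h, g^-1 * h \in S -> g = h} &
  forall g, exists2 h, h \in s & h^-1 * g \in S].
Proof.
have memS g : lcoset_of g \in fset_set (lcosets_of S).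
  by rewrite in_fset_set// inE lcosets_ofE; exists g.
pose rep (C : set G) := xget 1 C.
have repK C : C \in fset_set (lcosets_of S) -> lcoset_of (rep C) = C.
  rewrite in_fset_set// inE lcosets_ofE => -[g _ <-]; apply/esym/lcoset_ofP.
  rewrite /rep; case: xgetP => [x _ //|/(_ g)].
  by rewrite /lcoset_of /= mulVg gpred1 => /(_ isT).
exists [seq rep C | C <- fset_set (lcosets_of S)]; split.
- rewrite map_inj_in_uniq ?fset_uniq// => C C' CS C'S e.
  by rewrite -(repK C)// e repK.
- by rewrite size_map.
- move=> _ _ /mapP[C CS ->] /mapP[C' C'S ->] /lcoset_ofP.
  by rewrite !repK// => ->.
move=> g; exists (rep (lcoset_of g)).
  by apply: map_f; apply: memS.
by apply/lcoset_ofP/repK.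
Qed.

Lemma index_of_gt0 : (0 < index_of S)%N.
Proof.
have [s [_ <- _ cov]] := index_reps.
by have [h] := cov 1; case: s {cov}.
Qed.

End Cosets.

Lemma choose_reps (T : eqType) (E : T -> T -> Prop) (s : seq T) :
  (forall x, E x x) -> (forall x y, E x y -> E y x) ->
  exists r, [/\ uniq r, {subset r <= s}, {in r &, forall x y, E x y -> x = y} &
    forall x, x \in s -> exists2 y, y \in r & E x y].
Proof.
move=> Er Es; elim: s => [|x s [r [ur rs rinj rcov]]]; first by exists [::].
have [[y yr xy]|nox] := pselect (exists2 y, y \in r & E x y).
  exists r; split=> // [z /rs zs|z]; first by rewrite inE zs orbT.
  by rewrite inE => /orP[/eqP->|/rcov//]; exists y.
exists (x :: r); split=> [|z|z w|z].
- rewrite /= ur andbT; apply/negP => xr; apply: nox; by exists x.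
- by rewrite !inE => /orP[->//|/rs->]; rewrite orbT.
- rewrite !inE => /orP[/eqP->|zr] /orP[/eqP->|wr] // zw.
  + by case: nox; exists w.
  + by case: nox; exists z => //; apply: Es.
  exact: rinj.
rewrite inE => /orP[/eqP->|/rcov[y yr zy]].
  by exists x; rewrite ?mem_head.
by exists y; rewrite // inE yr orbT.
Qed.

Section DoubleCosets.
Variables (G : groupType) (D L : groupClosed G).
Hypothesis Lnormal : normal_subgrp L.
Hypothesis Lfin : finite_index L.
Local Open Scope group_scope.
Local Notation P := (subgrp_preim D L).

Lemma normal_subgrp_conj g x : x \in L -> g * x * g^-1 \in L.
Proof. by move=> /(Lnormal g^-1); rewrite conjgE invgK mulgA. Qed.

Lemma finite_index_preim : finite_index P.
Proof.
have [s [_ _ _ cov]] := index_reps Lfin.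
pose pick h := xget 1 [set d : subgrp D | h^-1 * val d \in L]%classic.
apply: (@finite_index_cover _ _ [seq pick h | h <- s]) => d.
have [h hs hd] := cov (val d); exists (pick h); first exact: map_f.
have hp : h^-1 * val (pick h) \in L.
  by rewrite /pick; case: xgetP => [e _ //|/(_ d)].
rewrite mem_subgrp_preim.
have -> : val ((pick h)^-1 * d) = (h^-1 * val (pick h))^-1 * (h^-1 * val d).
  by rewrite invgM invgK mulgA mulgK.
by rewrite gpredM ?gpredV.
Qed.

(* [x] and [g] lie in the same double coset of [L] and [D]; as [L] is normal,
   this is the coset [g D L]. *)
Definition same_dcoset (x g : G) : Prop :=
  exists d : subgrp D, (g * val d)^-1 * x \in L.

Lemma same_dcoset_refl x : same_dcoset x x.
Proof. by exists 1; rewrite mulg1 mulVg gpred1. Qed.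

Lemma same_dcoset_sym x y : same_dcoset x y -> same_dcoset y x.
Proof.
case=> d dL; exists d^-1.
have -> : (x * val d^-1)^-1 * y = val d * ((y * val d)^-1 * x)^-1 * (val d)^-1.
  by rewrite !invgM !invgK !mulgA mulgK.
by apply: normal_subgrp_conj; rewrite gpredV.
Qed.

Lemma same_dcoset_trans x y z :
  same_dcoset x y -> same_dcoset y z -> same_dcoset x z.
Proof.
case=> d dL [e eL]; exists (e * d).
have -> : (z * val (e * d))^-1 * x =
    ((z * val e)^-1 * y) ^ (val d) * ((y * val d)^-1 * x).
  by rewrite -[val (e * d)]/(val e * val d) conjgE !invgM !mulgA !mulgK.
by rewrite gpredM// Lnormal.
Qed.

(** Representatives are selected among those of the cosets of L. The index bound holds because the
    products of a double coset representative with a representative of D modulo its trace lie in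
    distinct cosets of L. *)
Lemma dcoset_reps : exists r : seq G, [/\ uniq r,
  {in r &, forall g h, same_dcoset g h -> g = h},
  forall x, exists2 g, g \in r & same_dcoset x g &
  (size r * index_of P <= index_of L)%N].
Proof.
have [s [_ _ _ scov]] := index_reps Lfin.
have [r [ur _ rinj rcov]] := choose_reps s same_dcoset_refl same_dcoset_sym.
have [t [ut <- tinj _]] := index_reps finite_index_preim.
exists r; split=> // [x|].
  have [h hs hx] := scov x; have [g gr hg] := rcov h hs.
  exists g => //; apply: same_dcoset_trans hg; exists 1; by rewrite mulg1.
have key g g' (d d' : subgrp D) : g \in r -> g' \in r -> d \in t -> d' \in t ->
    (g * val d)^-1 * (g' * val d') \in L -> g = g' /\ d = d'.
  move=> gr g'r dt d't dL.
  have gg' : g = g'.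
    apply/esym/rinj => //; exists (d * d'^-1).
    have -> : (g * val (d * d'^-1))^-1 * g' =
        val d' * ((g * val d)^-1 * (g' * val d')) * (val d')^-1.
      by rewrite !invgM invgK !mulgA mulgK.
    exact: normal_subgrp_conj.
  split=> //; apply: tinj => //; rewrite mem_subgrp_preim.
  by move: dL; rewrite gg' invgM -!mulgA mulKg.
rewrite -(size_allpairs (fun g (d : subgrp D) => g * val d)).
apply: (size_le_index Lfin).
  apply: allpairs_uniq => // -[g d] [g' d'].
  move=> /allpairsP[[? ?] [/= gr dt [-> ->]]].
  move=> /allpairsP[[? ?] [/= g'r d't [-> ->]]] /= e.
  by have [|-> ->] := key _ _ _ _ gr g'r dt d't; rewrite ?e ?mulVg ?gpred1.
move=> _ _ /allpairsP[[g d] [/= gr dt ->]] /allpairsP[[g' d'] [/= g'r d't ->]].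
by move=> /(key _ _ _ _ gr g'r dt d't)[-> ->].
Qed.

End DoubleCosets.

Lemma residual_chain_preim (G : groupType) (D : groupClosed G)
    (L : nat -> groupClosed G) :
  residual_chain L -> residual_chain (fun i => subgrp_preim D (L i)).
Proof.
move=> [L0 LS Ln Li Lc]; split.
- by move=> x; exact: L0.
- by move=> i x; exact: LS.
- by move=> i x g; exact: (Ln i (val x) (val g)).
- by move=> i; exact: finite_index_preim.
by move=> x xL; apply: val_inj; apply: Lc => i; exact: xL.
Qed.

(** * Coinvariants of induced modules *)

Lemma groupring_ind (H : groupType) (Q : groupring H -> Prop) :
  Q 0 -> (forall x y, Q x -> Q y -> Q (x - y)) ->
  (forall k : H, Q << k >>) -> forall x, Q x.
Proof. exact: malg_ind. Qed.

Section InducedModule.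
Variables (G : groupType) (D : groupClosed G).
Variable M : lmodType (groupring (subgrp D)).
Local Notation incl := (subgrp_incl D).

Lemma etensBl (x x' : groupring G) (m : M) :
  etens incl (x - x') m = etens incl x m - etens incl x' m.
Proof.
have := @etensDl _ _ incl M (x - x') x' m.
by rewrite subrK => ->; rewrite addrK.
Qed.

Lemma etens0l (m : M) : etens incl 0 m = 0.
Proof. by rewrite -(subrr 0) etensBl subrr. Qed.

Lemma induced_ind (Q : extend incl M -> Prop) : Q 0 ->
  (forall w w', Q w -> Q w' -> Q (w - w')) ->
  (forall (k : G) m, Q (etens incl << k >> m)) -> forall w, Q w.
Proof.
move=> Q0 QB QU; elim/ext_ind => // x m.
elim/groupring_ind: x => [|x y Qx Qy|k]; last exact: QU.
  by rewrite etens0l.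
by rewrite etensBl; exact: QB.
Qed.

(** Both sides are additive in r and in x, so group elements suffice in both places. *)
Lemma balanced_on_basis (V : zmodType) (b : groupring G -> M -> V) :
  (forall x x' m, b (x - x') m = b x m - b x' m) ->
  (forall x m m', b x (m - m') = b x m - b x m') ->
  (forall (k : G) (d : subgrp D) m, b << (k * val d)%g >> m =
     b << k >> ((<< d >> : groupring (subgrp D)) *: m)) ->
  forall x (r : groupring (subgrp D)) m, b (x * incl r) m = b x (r *: m).
Proof.
move=> bBl bBr bM x r m.
have b0l m' : b 0 m' = 0 by rewrite -(subrr (0 : groupring G)) bBl subrr.
have b0r x' : b x' 0 = 0 by rewrite -(subrr (0 : M)) bBr subrr.
elim/groupring_ind: r => [|r s hr hs|d].
- by rewrite rmorph0 mulr0 scale0r b0l b0r.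
- by rewrite rmorphB mulrBr scalerBl bBl bBr -hr -hs.
rewrite subgrp_inclU; elim/groupring_ind: x => [|x y hx hy|k].
- by rewrite mul0r !b0l.
- by rewrite mulrBl !bBl hx hy.
by rewrite groupring_mulUU bM.
Qed.

Section Lift.
Variables (V : zmodType) (c : G -> M -> V).
Hypotheses (cD : forall k, {morph c k : m m' / m + m'})
  (cM : forall k (d : subgrp D) m,
    c (k * val d)%g m = c k ((<< d >> : groupring (subgrp D)) *: m)).

Let b (x : groupring G) (m : M) : V := mlift (c^~ m) x.

Let bU (k : G) m : b << k >> m = c k m.
Proof. exact: mliftU1. Qed.

Let bBl x x' m : b (x - x') m = b x m - b x' m.
Proof. exact: (mlift_is_additive (c^~ m)). Qed.

Let b0l m : b 0 m = 0.
Proof. by have := bBl 0 0 m; rewrite (subrr (0 : groupring G)) subrr. Qed.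

Let bDl x x' m : b (x + x') m = b x m + b x' m.
Proof. by apply: (addIr (- b x' m)); rewrite -bBl !addrK. Qed.

Let bDr x m m' : b x (m + m') = b x m + b x m'.
Proof.
elim/groupring_ind: x => [|x y hx hy|k]; first by rewrite !b0l addr0.
  by rewrite !bBl hx hy opprD addrACA.
by rewrite !bU cD.
Qed.

Let bBr x m m' : b x (m - m') = b x m - b x m'.
Proof. by have := bDr x (m - m') m'; rewrite subrK => ->; rewrite addrK. Qed.

Let bM x (r : groupring (subgrp D)) m : b (x * incl r) m = b x (r *: m).
Proof.
apply: balanced_on_basis => // k d m'; by rewrite !bU cM.
Qed.

Lemma ind_lift : {f : {additive extend incl M -> V} |
  forall k m, f (etens incl << k >> m) = c k m}.
Proof.
exists (tensor_lift (M := ring_rmod incl) bDl bDr bM) => k m.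
by rewrite -bU; exact: tensor_liftE.
Qed.

End Lift.
End InducedModule.

(** * Splitting along double cosets *)

Section Induced.
Variables (F : fieldType) (G : groupType) (D L : groupClosed G).
Hypothesis Lnormal : normal_subgrp L.
Local Notation P := (subgrp_preim D L).
Local Notation incl := (subgrp_incl D).
Implicit Types (M N : lmodType (groupring (subgrp D))) (g k : G).

Let ind M : lmodType (groupring G) := extend incl M.

Lemma ind_pi_inv M (h k : G) (m : M) : h \in L ->
  coinv_pi F L (etens incl << (h * k)%g >> m : ind M) =
  coinv_pi F L (etens incl << k >> m : ind M).
Proof.
move=> hL.
have e : (<< h >> : groupring G) *: (etens incl << k >> m : ind M) =
    etens incl << (h * k)%g >> m.
  by rewrite -groupring_mulUU; exact: etensZ.
have q := @coinv_pi_inv F G L (ind M) h (etens incl << k >> m) hL.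
by rewrite e in q.
Qed.

Section Embedding.
Variables (M : lmodType (groupring (subgrp D))) (g : G).

Let b (m : M) : coinv F L (ind M) :=
  coinv_pi F L (etens incl << g >> m : ind M).

Let bD : {morph b : m m' / m + m'}.
Proof. by move=> m m'; rewrite /b etensDr coinv_piD. Qed.

Let bP (d : subgrp D) m : d \in P ->
  b ((<< d >> : groupring (subgrp D)) *: m) = b m.
Proof.
move=> dP; rewrite /b -etensM subgrp_inclU groupring_mulUU.
(* Moving d to the left of g turns it into a conjugate, which lies in L by normality and is
   forgotten by the coinvariants. *)
have gdL : (g * val d * g^-1)%g \in L by exact: normal_subgrp_conj.
by have := ind_pi_inv g m gdL; rewrite mulgVK.
Qed.

Definition ind_embed : {linear coinv F P M -> coinv F L (ind M)} :=
  coinv_lift bD bP.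

Lemma ind_embedE m :
  ind_embed (coinv_pi F P m) = coinv_pi F L (etens incl << g >> m : ind M).
Proof. exact: coinv_liftE. Qed.

End Embedding.

Section Projection.
Variables (M : lmodType (groupring (subgrp D))) (g : G).

(** A d with k in [g d L]. When k is outside [g D L] the default 1 fails the membership test in
    [dcoset_coef]. *)
Definition dcoset_comp (k : G) : subgrp D :=
  xget 1%g [set d : subgrp D | (g * val d)^-1 * k \in L]%g%classic.

(** The projection to the summand of g on a generator: if k lies in [g d L], then k tensor m has the
    same class as g tensor [d m]. *)
Definition dcoset_coef (k : G) (m : M) : coinv F P M :=
  if ((g * val (dcoset_comp k))^-1 * k)%g \in L
  then coinv_pi F P ((<< dcoset_comp k >> : groupring (subgrp D)) *: m)
  else 0.

(** Independence of the chosen component: two candidates e and d for the same k satisfy [e d^-1] in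
    P, which acts trivially on the coinvariants. *)
Lemma dcoset_coef_in k d m : ((g * val d)^-1 * k)%g \in L ->
  dcoset_coef k m = coinv_pi F P ((<< d >> : groupring (subgrp D)) *: m).
Proof.
move=> dL; rewrite /dcoset_coef /dcoset_comp.
case: xgetP => [e _ /= eL|/(_ d)//]; rewrite eL.
have ed : (e * d^-1)%g \in P.
  rewrite mem_subgrp_preim.
  have -> : (val (e * d^-1) =
      val d * (((g * val d)^-1 * k) * ((g * val e)^-1 * k)^-1) * (val d)^-1)%g.
    rewrite -[val (e * d^-1)%g]/(val e * (val d)^-1)%g !invgM !invgK !mulgA.
    by rewrite mulgK mulgV mul1g mulVg mul1g.
  by apply: normal_subgrp_conj; rewrite // gpredM// gpredV.
rewrite -[RHS](coinv_pi_inv F _ ed) scalerA groupring_mulUU.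
by rewrite mulgVK.
Qed.

Lemma dcoset_coef_out k m : ~ same_dcoset D L k g -> dcoset_coef k m = 0.
Proof.
move=> kg; rewrite /dcoset_coef.
have [kL|//] := boolP (((g * val (dcoset_comp k))^-1 * k)%g \in L).
by case: kg; exists (dcoset_comp k).
Qed.

Lemma dcoset_coefD k : {morph dcoset_coef k : m m' / m + m'}.
Proof.
move=> m m'; rewrite /dcoset_coef.
have [_|_] := boolP (((g * val (dcoset_comp k))^-1 * k)%g \in L).
  by rewrite (scalerDr _ m m'); exact: coinv_piD.
exact: esym (addr0 _).
Qed.

Lemma dcoset_coefMr k (d : subgrp D) m :
  dcoset_coef (k * val d)%g m =
  dcoset_coef k ((<< d >> : groupring (subgrp D)) *: m).
Proof.
have [[e eL]|kg] := pselect (same_dcoset D L k g).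
  rewrite (dcoset_coef_in _ eL) (@dcoset_coef_in _ (e * d)%g).
    by rewrite scalerA groupring_mulUU.
  have -> : ((g * val (e * d))^-1 * (k * val d) =
      ((g * val e)^-1 * k) ^ (val d))%g.
    by rewrite -[val (e * d)%g]/(val e * val d)%g conjgE !invgM !mulgA.
  exact: Lnormal.
rewrite !dcoset_coef_out// => -[e eL]; apply: kg; exists (e * d^-1)%g.
have -> : ((g * val (e * d^-1))^-1 * k =
    val d * ((g * val e)^-1 * (k * val d)) * (val d)^-1)%g.
  rewrite -[val (e * d^-1)%g]/(val e * (val d)^-1)%g.
  by rewrite !invgM invgK !mulgA mulgK.
exact: normal_subgrp_conj.
Qed.

(** As L is normal, left multiplication by h moves k within its left coset of L, so the same
    components remain valid. *)
Lemma dcoset_coefMl k h m : h \in L ->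
  dcoset_coef (h * k)%g m = dcoset_coef k m.
Proof.
move=> hL; have shift e : (((g * val e)^-1 * (h * k))%g \in L) =
    (((g * val e)^-1 * k)%g \in L).
  have -> : ((g * val e)^-1 * (h * k) =
      h ^ (g * val e) * ((g * val e)^-1 * k))%g.
    by move: (g * val e)%g => a; rewrite conjgE !mulgA mulgK.
  by rewrite gpredMl// Lnormal.
have [[e eL]|kg] := pselect (same_dcoset D L k g).
  by rewrite !(@dcoset_coef_in _ e)// shift.
by rewrite !dcoset_coef_out// => -[e]; rewrite shift => eL; apply: kg; exists e.
Qed.

Let lift_sig := ind_lift dcoset_coefD dcoset_coefMr.

Let lift := sval lift_sig.

Let liftD : {morph lift : w w' / w + w'}.
Proof. exact: raddfD. Qed.

Let liftE k m : lift (etens incl << k >> m) = dcoset_coef k m.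
Proof. exact: (svalP lift_sig k m). Qed.

Let liftL h (w : ind M) : h \in L ->
  lift ((<< h >> : groupring G) *: w) = lift w.
Proof.
move=> hL; elim/induced_ind: w => [|w w' hw hw'|k m]; first by rewrite scaler0.
  by rewrite scalerBr !raddfB hw hw'.
have -> : (<< h >> : groupring G) *: (etens incl << k >> m : ind M) =
    etens incl << (h * k)%g >> m by rewrite -groupring_mulUU; exact: etensZ.
exact: etrans (liftE (h * k)%g m)
  (etrans (dcoset_coefMl k m hL) (esym (liftE k m))).
Qed.

Definition ind_proj : {linear coinv F L (ind M) -> coinv F P M} :=
  coinv_lift liftD liftL.

Lemma ind_projE k m :
  ind_proj (coinv_pi F L (etens incl << k >> m : ind M)) = dcoset_coef k m.
Proof. by rewrite /ind_proj coinv_liftE liftE. Qed.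

End Projection.

Lemma coinv_ind_eq M (V : lmodType F) (f f' : coinv F L (ind M) -> V) :
  linear f -> linear f' ->
  (forall k m, f (coinv_pi F L (etens incl << k >> m : ind M)) =
               f' (coinv_pi F L (etens incl << k >> m : ind M))) -> f =1 f'.
Proof.
move=> lf lf' ff'; apply: coinv_eq => // w.
have z (h : coinv F L (ind M) -> V) : linear h -> h 0 = 0.
  move=> lh; have := lh 1 0 0; rewrite !scale1r addr0 => /esym/eqP.
  by rewrite -subr_eq0 addrK => /eqP.
have bb (h : coinv F L (ind M) -> V) : linear h -> forall u v : ind M,
    h (coinv_pi F L (u - v)) = h (coinv_pi F L u) - h (coinv_pi F L v).
  move=> lh u v; apply: (canRL (addrK _)).
  have e : 1 *: coinv_pi F L (u - v) + coinv_pi F L v = coinv_pi F L u.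
    by rewrite scale1r -coinv_piD subrK.
  by rewrite -[RHS](congr1 h e) lh scale1r.
elim/induced_ind: w => [|u v hu hv|k m]; last exact: ff'.
  by rewrite coinv_pi0 !z.
rewrite (bb f lf u v) (bb f' lf' u v).
have hu' : f (coinv_pi F L (u : ind M)) = f' (coinv_pi F L (u : ind M)) := hu.
exact: (congr2 (fun a b => a - b) hu' hv).
Qed.

Lemma ind_embed_natural M N (f : {linear M -> N}) g t :
  coinv_map F L (extend_map incl f) (ind_embed M g t) =
  ind_embed N g (coinv_map F P f t).
Proof.
apply: (coinv_eq
  (f := fun t => coinv_map F L (extend_map incl f) (ind_embed M g t))
  (f' := fun t => ind_embed N g (coinv_map F P f t))).
- by move=> a u v; rewrite !linearP.
- by move=> a u v; rewrite !linearP.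
move=> m; rewrite (ind_embedE g m) (@coinv_mapE F _ P _ _ f m).
rewrite (ind_embedE g (f m)).
apply: etrans (@coinv_mapE F G L _ _ (extend_map incl f) _) _.
exact: (congr1 (@coinv_pi F G L (ind N)) (extend_mapE incl f _ _)).
Qed.

(** The component of k depends on g and k but not on the module, so a linear map passes through each
    coefficient. *)
Lemma ind_proj_natural M N (f : {linear M -> N}) g t :
  coinv_map F P f (ind_proj M g t) =
  ind_proj N g (coinv_map F L (extend_map incl f) t).
Proof.
apply: (coinv_ind_eq (f := fun t => coinv_map F P f (ind_proj M g t))
  (f' := fun t => ind_proj N g (coinv_map F L (extend_map incl f) t))).
- by move=> a u v; rewrite !linearP.
- by move=> a u v; rewrite !linearP.
move=> k m; have e := @coinv_mapE F G L _ _ (extend_map incl f)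
  (etens incl << k >> m).
rewrite extend_mapE in e; rewrite e (ind_projE g k m) (ind_projE g k (f m)).
rewrite /dcoset_coef.
have [_|_] := boolP (((g * val (dcoset_comp g k))^-1 * k)%g \in L).
  by rewrite coinv_mapE linearZ.
exact: linear0.
Qed.

(** On a generator k tensor m only the representative g of the double coset of k contributes. It
    returns the class of [g d] tensor m, where k and [g d] differ by an element of L. *)
Lemma ind_decomp M (r : seq G) (t : coinv F L (ind M)) : uniq r ->
  {in r &, forall g h, same_dcoset D L g h -> g = h} ->
  (forall x, exists2 g, g \in r & same_dcoset D L x g) ->
  t = \sum_(g <- r) ind_embed M g (ind_proj M g t).
Proof.
move=> ur rinj rcov.
apply: (coinv_ind_eq (f := id)
  (f' := fun t => \sum_(g <- r) ind_embed M g (ind_proj M g t))) => //.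
  move=> a u v; rewrite scaler_sumr -big_split; apply: eq_bigr => g _.
  by rewrite !linearP.
move=> k m; have [g gr kg] := rcov k.
rewrite (bigD1_seq g)//= big1_seq ?addr0 => [|h /andP[hg hr]]; last first.
  transitivity (ind_embed M h 0); last exact: linear0.
  apply: congr1; apply: (etrans (ind_projE h k m)).
  apply: dcoset_coef_out => kh.
  case/eqP: hg; apply: rinj => //; apply: same_dcoset_trans kg => //.
  exact: same_dcoset_sym.
case: kg => d dL.
apply: etrans (esym (congr1 (ind_embed M g)
  (etrans (ind_projE g k m) (dcoset_coef_in m dL)))).
apply: etrans (esym (ind_embedE _ _)).
have -> : etens incl << g >> ((<< d >> : groupring (subgrp D)) *: m) =
    etens incl << (g * val d)%g >> m.
  by rewrite -etensM subgrp_inclU groupring_mulUU.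
have kL : (k * (g * val d)^-1)%g \in L.
  have -> : (k * (g * val d)^-1 =
      (g * val d) * ((g * val d)^-1 * k) * (g * val d)^-1)%g by rewrite mulVKg.
  exact: normal_subgrp_conj.
by have := ind_pi_inv (g * val d)%g m kL; rewrite mulgVK.
Qed.

End Induced.

Section InducedHomology.
Variables (R : realType) (F : fieldType) (G : groupType) (D L : groupClosed G).
Hypotheses (Lnormal : normal_subgrp L) (Lfin : finite_index L).
Variable Z : chain_complex (groupring (subgrp D)).
Local Notation P := (subgrp_preim D L).

Lemma coinv_homology_induced k :
  (dimE R (homology (base_change F (coinvariants L (induced Z))) (k - 1))
     / (index_of L)%:R%:E <=
   dimE R (homology (base_change F (coinvariants P Z)) (k - 1))
     / (index_of P)%:R%:E)%E.
Proof.
have [r [ur rinj rcov rle]] := dcoset_reps D Lnormal Lfin.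
apply: (dimE_div_le _ _ rle) => [||n hn].
- exact: index_of_gt0 (finite_index_preim D Lfin).
- exact: index_of_gt0.
apply: (proj2 (coinv_homology_dim_le R F L (induced Z) k _)).
have {}hn := proj1 (coinv_homology_dim_le R F P Z k n) hn.
apply: (dim_le_retract
  (phi := fun g => ind_embed F Lnormal (Z (k - 1)) g)
  (psi := fun g => ind_proj F Lnormal (Z (k - 1)) g) _ _ _ _ _ hn).
- exact: subspace_coinv_boundary.
- move=> g t tZ.
  apply: etrans (ind_embed_natural Lnormal (cc_d Z (k - 1)) g t) _.
  by rewrite tZ linear0.
- move=> g _ [t ->]; exists (ind_embed F Lnormal (Z k) g t).
  exact: esym (ind_embed_natural Lnormal (cc_d Z k) g t).
- move=> g t tZ.
  apply: etrans (ind_proj_natural Lnormal (cc_d Z (k - 1)) g t) _.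
  apply: etrans (congr1 _ tZ) _; exact: linear0.
by move=> t _; exact: ind_decomp.
Qed.

End InducedHomology.

(** * The bootstrapping axioms *)

Theorem proposition4p17 (R : realType) (F : fieldType) :
  equivariantly_bootstrappable (@H_class R F).
Proof.
have u_ge0 (G : groupType) (L : nat -> groupClosed G)
    (X : chain_complex (groupring G)) j i :
    (0 <= dimE R (homology (base_change F (coinvariants (L i) X)) j)
       / (index_of (L i))%:R%:E)%E.
  by rewrite mule_ge0 ?dimE_ge0// inve_ge0 lee_fin ler0n.
split=> G _.
- move=> n X Y XY hX L hL j jn; apply: limn_esup_eq0_le (hX L hL j jn) => i.
  rewrite u_ge0 /=; apply: lee_wpmul2r; last exact: coinv_homology_iso.
  by rewrite inve_ge0 lee_fin ler0n.
- move=> X hX m m0 L _ j jm.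
  have j0 : j < 0 by exact: le_lt_trans jm m0.
  apply: limn_esup_eq0_le (cvg_limn_einf_sup (cvg_cst 0%E)).2 => i.
  by rewrite u_ge0 /= coinv_homology_deg// mul0e.
- move=> n X; split=> hX L hL j jn.
    move: jn; elim/int_pred_ind: j => k kn.
    have kn' : k - 1 - 1 <= n by rewrite lerBlDr.
    apply: limn_esup_eq0_le (hX L hL _ kn') => i.
    by rewrite u_ge0 /= coinv_homology_susp.
  (* The degree is shifted twice, since degree [k - 1 - 1] of X corresponds to degree [k - 1] of the
     suspension. *)
  move: jn; elim/int_pred_ind: j; elim/int_pred_ind => k kn.
  have kn' : k - 1 <= n + 1 by rewrite -lerBlDr.
  apply: limn_esup_eq0_le (hX L hL _ kn') => i.
  by rewrite u_ge0 /= coinv_homology_susp.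
- move=> n X Y f hX hY L hL j; elim/int_pred_ind: j => k kn.
  have kn' : k - 1 - 1 <= n - 1 by rewrite lerB.
  apply: limn_esup_eq0_le
    (limn_esup_eq0D (u_ge0 _ _ _ _) (u_ge0 _ _ _ _)
       (hX L hL _ kn') (hY L hL _ kn)).
  move=> i; rewrite u_ge0 /= -ge0_muleDl ?dimE_ge0//.
  apply: lee_wpmul2r; last exact: coinv_homology_cone.
  by rewrite inve_ge0 lee_fin ler0n.
move=> n D Z hZ L hL j; elim/int_pred_ind: j => k kn.
apply: limn_esup_eq0_le (hZ _ (residual_chain_preim D hL) _ kn) => i.
rewrite u_ge0 /=; apply: coinv_homology_induced.
  exact: (rc_normal hL).
exact: rc_index.
Qed.
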